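(* (Composition-Diamond lemma for dialgebras) Let $\mathbf{k}$ be a field, $X$ a well-ordered set, $S$ a monic subset of the free dialgebra $Di\langle X\rangle$ over $\mathbf{k}$, $>$ a monomial-center ordering on $[X^+]_\omega$, and $Id(S)$ the ideal of $Di\langle X\rangle$ generated by $S$. Then the following statements are equivalent. (i) $S$ is a Gröbner-Shirshov basis in $Di\langle X\rangle$. (ii) For every nonzero $f\in Id(S)$, $\overline{f}=\overline{[asb]_m}$ for some normal $S$-diword $[asb]_m$. (iii) The set $Irr(S)=\{[u]_n\in [X^+]_\omega\mid [u]_n\neq \overline{[asb]_m}\text{ for any normal }S\text{-diword }[asb]_m\}$ is a $\mathbf{k}$-basis of the quotient dialgebra $Di\langle X\mid S\rangle:=Di\langle X\rangle/Id(S)$.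
   Context: Free dialgebra. A dialgebra over $\mathbf{k}$ is a $\mathbf{k}$-module with two $\mathbf{k}$-bilinear associative products $\vdash,\dashv$ satisfying $a\dashv(b\vdash c)=a\dashv(b\dashv c)$, $(a\dashv b)\vdash c=(a\vdash b)\vdash c$, $a\vdash(b\dashv c)=(a\vdash b)\dashv c$. $X^+$ is the set of nonempty words on $X$, $X^*$ the set of all words including the empty one, $|u|$ the length of $u$. $[X^+]_\omega=\{[u]_m\mid u\in X^+,\ 1\le m\le |u|\}$ is the set of normal diwords (formal pairs $(u,m)$); $u$ is the associative word and $p([u]_m)=m$ the position of center. $Di\langle X\rangle$ is the $\mathbf{k}$-space with basis $[X^+]_\omega$ and products $[u]_m\vdash[v]_n=[uv]_{|u|+n}$, $[u]_m\dashv[v]_n=[uv]_m$ extended bilinearly; it is the free dialgebra on $X$ ($x\in X$ is identified with $[x]_1$). An ideal is a subspace closed under both products, on both sides, with arbitrary elements. Orderings. A monomial ordering on $X^+$ is a well (total) ordering with $u>v\Rightarrow uw>vw,\ wu>wv$. The associated monomial-center ordering on $[X^+]_\omega$ is: $[u]_m>[v]_n$ iff $(u,m)>(v,n)$ lexicographically. For $0\ne f\in Di\langle X\rangle$: $\overline f$ is the leading (largest) normal diword of $f$, $lc(f)$ its coefficient, $lt(f)=lc(f)\overline f$, $\widetilde f$ the associative word of $\overline f$, $r_f=f-lt(f)$. By convention $0$ is smaller than every diword and every word, and $\overline 0=\widetilde 0=0$. $f\neq0$ is monic if $lc(f)=1$; a set is monic if all its elements are. $f\ne0$ is strong if $\widetilde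 f>\widetilde{r_f}$ (in particular if $r_f=0$). Normal $S$-diwords. For $s\in S$, $a,b\in X^*$ put $P([asb])=\{n: 1\le n\le|a|\}\cup\{|a|+p(\overline s)\}\cup\{n:|a\widetilde s|<n\le|a\widetilde sb|\}$ if $s$ is strong, and $P([asb])=\{|a|+p(\overline s)\}$ if $s$ is not strong. For $l\in P([asb])$ the normal $S$-diword (normal $s$-diword) $[asb]_l$ is the element: $[a]_l\dashv s\dashv[b]_1$ if $l\le|a|$; $[a]_{|a|}\vdash s\dashv[b]_1$ if $l=|a|+p(\overline s)$; $[a]_{|a|}\vdash s\vdash[b]_{l-|a\widetilde s|}$ if $l>|a\widetilde s|$ (factors with empty word omitted). One has $\overline{[asb]_l}=[a\widetilde sb]_l$. Compositions of monic $f,g\in Di\langle X\rangle$ (same notation $[afb]_l$, $P$ used for single polynomials): 1) If $f$ is not strong: $x\dashv f$ for all $x\in X$ (left multiplication) and $f\vdash[u]_{|u|}$ for all $u\in X^+$ (right multiplication). 2) If $w=\widetilde f=a\widetilde gb$, $a,b\in X^*$: if $p(\overline f)\in P([agb])$, the composition of inclusion $f-[agb]_{p(\overline f)}$; if $p(\overline f)\notin P([agb])$ and both $f,g$ are strong, for every $x\in X$ the compositions of left and right multiplicative inclusion $[xf]_1-[xagb]_1$ and $[fx]_{|wx|}-[agbx]_{|wx|}$. 3) If $w=\widetilde fb=a\widetilde g$, $a,b\in X^*$, $|\widetilde f|+|\widetilde g|>|w|$: if $P([fb])\cap P([ag])\ne\varnothing$, for every $m$ in it the composition of intersection $[fb]_m-[ag]_m$;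 if $P([fb])\cap P([ag])=\varnothing$ and both $f,g$ are strong, for every $x\in X$ the compositions of left and right multiplicative intersection $[xfb]_1-[xag]_1$ and $[fbx]_{|wx|}-[agx]_{|wx|}$. $h\in Di\langle X\rangle$ is trivial modulo $S$ if $h=\sum\alpha_i[a_is_ib_i]_{m_i}$ is a finite sum with $\alpha_i\in\mathbf{k}$, $[a_is_ib_i]_{m_i}$ normal $S$-diwords and $\overline{[a_is_ib_i]_{m_i}}\le\overline h$. A monic set $S$ is a Gröbner-Shirshov basis if every composition of elements of $S$ is trivial modulo $S$. In (iii), being a basis of the quotient means that the images of the elements of $Irr(S)$ are distinct and form a basis. *)

(* Defs.v *)
From HB Require Import structures.
From mathcomp Require Import all_boot all_order all_algebra.
From mathcomp Require Import finmap monalg.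
From mathcomp Require Import boolp classical_sets.

Set Implicit Arguments.
Unset Strict Implicit.
Unset Printing Implicit Defensive.

Import GRing.Theory.

Local Open Scope classical_set_scope.
Local Open Scope ring_scope.

Reserved Notation "x ⊢ y" (at level 40, left associativity).
Reserved Notation "x ⊣ y" (at level 40, left associativity).

HB.mixin Record Lmodule_isDialgebra (k : pzRingType) V of GRing.Lmodule k V := {
  vdash : V -> V -> V;
  dashv : V -> V -> V;
  vdash_linl : forall b, linear (fun a => vdash a b);
  vdash_linr : forall a, linear (vdash a);
  dashv_linl : forall b, linear (fun a => dashv a b);
  dashv_linr : forall a, linear (dashv a);
  vdashA : associative vdash;
  dashvA : associative dashv;
  dashv_vdash : forall a b c, dashv a (vdash b c) = dashv a (dashv b c);
  vdash_dashv : forall a b c, vdash (dashv a b) c = vdash (vdash a b) c;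
  vdash_dashvA : forall a b c, vdash a (dashv b c) = dashv (vdash a b) c
}.

#[short(type="dialgType")]
HB.structure Definition Dialgebra (k : pzRingType) :=
  { V of GRing.Lmodule k V & Lmodule_isDialgebra k V }.

Notation "x ⊢ y" := (vdash x y) : ring_scope.
Notation "x ⊣ y" := (dashv x y) : ring_scope.

Section Ideals.
Context {k : pzRingType} {D : dialgType k}.

Definition is_ideal (I : set D) : Prop :=
  [/\ I 0,
      forall (c : k) (f g : D), I f -> I g -> I (c *: f + g)
    & forall f g : D, I f -> [/\ I (f ⊢ g), I (f ⊣ g), I (g ⊢ f) & I (g ⊣ f)]].

Definition Id (S : set D) : set D :=
  [set f | forall I : set D, is_ideal I -> S `<=` I -> I f].

Lemma Id_ideal (S : set D) : is_ideal (Id S).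
Proof.
split=> [I [] //|c f g If Ig I hI SI|f g If].
  by case: (hI) => _ + _; apply; [exact: If|exact: Ig].
by split=> I hI SI; have [_ _ /(_ f g (If I hI SI)) []] := hI.
Qed.

Definition Idp (S : set D) : {pred D} := fun f => `[< Id S f >].

Lemma IdpP (S : set D) f : reflect (Id S f) (f \in Idp S).
Proof. exact: asboolP. Qed.

Fact Idp_zmod_closed (S : set D) : zmod_closed (Idp S).
Proof.
have [I0 IZ _] := Id_ideal S; split; first exact/IdpP.
move=> f g /IdpP If /IdpP Ig; apply/IdpP.
by rewrite addrC -scaleN1r; apply: IZ.
Qed.

HB.instance Definition _ (S : set D) :=
  GRing.isZmodClosed.Build D (Idp S) (Idp_zmod_closed S).

End Ideals.

Section QuotientDialgebra.
Context {k : pzRingType} {D : dialgType k} (S : set D).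

Definition dquot : Type := Quotient.quot (Idp S).

HB.instance Definition _ := GRing.Zmodule.on dquot.

Definition dpi (f : D) : dquot := (\pi_(Quotient.quot (Idp S)) f)%qT.

Definition drepr (q : dquot) : D := repr (q : Quotient.quot (Idp S)).

Lemma dreprK : cancel drepr dpi.
Proof. exact: reprK. Qed.

Lemma dpiP f g : dpi f = dpi g <-> Id S (f - g).
Proof.
split=> [e|/IdpP h]; first by apply/IdpP; rewrite Quotient.idealrBE; apply/eqP.
by apply/eqP; rewrite -Quotient.idealrBE.
Qed.

Lemma dpiD f g : dpi (f + g) = dpi f + dpi g.
Proof. by rewrite /dpi raddfD. Qed.

Definition dq_scale (c : k) (q : dquot) : dquot := dpi (c *: drepr q).
Definition dq_vdash (p q : dquot) : dquot := dpi (drepr p ⊢ drepr q).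
Definition dq_dashv (p q : dquot) : dquot := dpi (drepr p ⊣ drepr q).

Lemma drepr_dpi f : Id S (drepr (dpi f) - f).
Proof. by apply/dpiP; rewrite dreprK. Qed.

Lemma dpi_scale c f : dq_scale c (dpi f) = dpi (c *: f).
Proof.
apply/dpiP; rewrite -scalerBr -[_ *: _]addr0.
by have [I0 IZ _] := Id_ideal S; apply: IZ => //; apply: drepr_dpi.
Qed.

Lemma linB (f : D -> D) : linear f -> {morph f : x y / x - y}.
Proof.
by move=> lf x y; rewrite addrC -scaleN1r lf scaleN1r addrC.
Qed.

Lemma dpi_vdash f g : dq_vdash (dpi f) (dpi g) = dpi (f ⊢ g).
Proof.
apply/dpiP; set f' := drepr _; set g' := drepr _.
have [I0 IZ IM] := Id_ideal S.
have -> : f' ⊢ g' - f ⊢ g = 1 *: ((f' - f) ⊢ g') + f ⊢ (g' - g).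
  by rewrite scale1r (linB (vdash_linl _)) (linB (vdash_linr _)) addrA subrK.
apply: IZ; first by have [] := IM _ g' (drepr_dpi f).
by have [] := IM _ f (drepr_dpi g).
Qed.

Lemma dpi_dashv f g : dq_dashv (dpi f) (dpi g) = dpi (f ⊣ g).
Proof.
apply/dpiP; set f' := drepr _; set g' := drepr _.
have [I0 IZ IM] := Id_ideal S.
have -> : f' ⊣ g' - f ⊣ g = 1 *: ((f' - f) ⊣ g') + f ⊣ (g' - g).
  by rewrite scale1r (linB (dashv_linl _)) (linB (dashv_linr _)) addrA subrK.
apply: IZ; first by have [] := IM _ g' (drepr_dpi f).
by have [] := IM _ f (drepr_dpi g).
Qed.

Lemma dquotW (P : dquot -> Prop) : (forall f, P (dpi f)) -> forall q, P q.
Proof. by move=> h q; rewrite -(dreprK q). Qed.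

Fact dq_scaleA a b q : dq_scale a (dq_scale b q) = dq_scale (a * b) q.
Proof. by elim/dquotW: q => f; rewrite !dpi_scale scalerA. Qed.
Fact dq_scale1 : left_id 1 dq_scale.
Proof. by elim/dquotW => f; rewrite dpi_scale scale1r. Qed.
Fact dq_scaleDr : right_distributive dq_scale +%R.
Proof.
move=> a; elim/dquotW=> f; elim/dquotW=> g.
by rewrite -dpiD !dpi_scale -dpiD scalerDr.
Qed.
Fact dq_scaleDl q : {morph dq_scale^~ q : a b / a + b}.
Proof.
by elim/dquotW: q => f a b; rewrite !dpi_scale -dpiD scalerDl.
Qed.

HB.instance Definition _ := GRing.Zmodule_isLmodule.Build k dquot
  dq_scaleA dq_scale1 dq_scaleDr dq_scaleDl.

Lemma dpi_linear : linear dpi.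
Proof. by move=> c f g; rewrite dpiD -dpi_scale. Qed.

HB.instance Definition _ := GRing.isLinear.Build k D dquot *:%R dpi dpi_linear.

Fact dq_vdash_linl b : linear (fun a => dq_vdash a b).
Proof.
elim/dquotW: b => h c p q; elim/dquotW: p => f; elim/dquotW: q => g.
by rewrite -linearP !dpi_vdash vdash_linl linearP.
Qed.
Fact dq_vdash_linr a : linear (dq_vdash a).
Proof.
elim/dquotW: a => h c p q; elim/dquotW: p => f; elim/dquotW: q => g.
by rewrite -linearP !dpi_vdash vdash_linr linearP.
Qed.
Fact dq_dashv_linl b : linear (fun a => dq_dashv a b).
Proof.
elim/dquotW: b => h c p q; elim/dquotW: p => f; elim/dquotW: q => g.
by rewrite -linearP !dpi_dashv dashv_linl linearP.
Qed.
Fact dq_dashv_linr a : linear (dq_dashv a).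
Proof.
elim/dquotW: a => h c p q; elim/dquotW: p => f; elim/dquotW: q => g.
by rewrite -linearP !dpi_dashv dashv_linr linearP.
Qed.
Fact dq_vdashA : associative dq_vdash.
Proof.
elim/dquotW=> f; elim/dquotW=> g; elim/dquotW=> h.
by rewrite !dpi_vdash vdashA.
Qed.
Fact dq_dashvA : associative dq_dashv.
Proof.
elim/dquotW=> f; elim/dquotW=> g; elim/dquotW=> h.
by rewrite !dpi_dashv dashvA.
Qed.
Fact dq_dashv_vdash a b c :
  dq_dashv a (dq_vdash b c) = dq_dashv a (dq_dashv b c).
Proof.
elim/dquotW: a => f; elim/dquotW: b => g; elim/dquotW: c => h.
by rewrite dpi_vdash !dpi_dashv dashv_vdash.
Qed.
Fact dq_vdash_dashv a b c :
  dq_vdash (dq_dashv a b) c = dq_vdash (dq_vdash a b) c.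
Proof.
elim/dquotW: a => f; elim/dquotW: b => g; elim/dquotW: c => h.
by rewrite dpi_dashv !dpi_vdash vdash_dashv.
Qed.
Fact dq_vdash_dashvA a b c :
  dq_vdash a (dq_dashv b c) = dq_dashv (dq_vdash a b) c.
Proof.
elim/dquotW: a => f; elim/dquotW: b => g; elim/dquotW: c => h.
by rewrite dpi_dashv !dpi_vdash dpi_dashv vdash_dashvA.
Qed.

HB.instance Definition _ := Lmodule_isDialgebra.Build k dquot
  dq_vdash_linl dq_vdash_linr dq_dashv_linl dq_dashv_linr dq_vdashA dq_dashvA
  dq_dashv_vdash dq_vdash_dashv dq_vdash_dashvA.

End QuotientDialgebra.

Arguments dpi {k D} S f.

Section Diwords.
Variable X : choiceType.

(* [u]_m is encoded as the pair (u, m); the bounds force u to be nonempty. *)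
Definition diword := {d : seq X * nat | 1 <= d.2 <= size d.1}%N.

HB.instance Definition _ := Choice.on diword.

Definition dword (d : diword) : seq X := (val d).1.
Definition dpos (d : diword) : nat := (val d).2.

Fact dw_vdash_subproof (d e : diword) :
  (1 <= size (dword d) + dpos e <= size (dword d ++ dword e))%N.
Proof.
have /andP[n1 nv] := valP e.
by rewrite size_cat leq_add2l nv (leq_trans n1) // leq_addl.
Qed.
Definition dw_vdash (d e : diword) : diword :=
  exist _ (dword d ++ dword e, size (dword d) + dpos e)%N
    (dw_vdash_subproof d e).

Fact dw_dashv_subproof (d e : diword) :
  (1 <= dpos d <= size (dword d ++ dword e))%N.
Proof.
have /andP[m1 mu] := valP d.
by rewrite size_cat m1 (leq_trans mu) // leq_addr.
Qed.
Definition dw_dashv (d e : diword) : diword :=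
  exist _ (dword d ++ dword e, dpos d) (dw_dashv_subproof d e).

End Diwords.

Definition Di (k : fieldType) (X : choiceType) : Type := {malg k[diword X]}.

HB.instance Definition _ (k : fieldType) (X : choiceType) :=
  GRing.Lmodule.on (Di k X).

HB.lock Definition diU (k : fieldType) (X : choiceType) (d : diword X) : Di k X :=
  mkmalgU d (1 : k).
Arguments diU {k X} d.

Section FreeDialgebra.
Context {k : fieldType} {X : choiceType}.
Implicit Types (f g h : Di k X) (d e i : diword X).

Definition dcoef f d : k := mcoeff d f.
Definition dsupp f : {fset diword X} := msupp f.

Lemma dcoefP f g : (forall d, dcoef f d = dcoef g d) <-> f = g.
Proof. exact: malgP. Qed.

Lemma dcoef0 d : dcoef 0 d = 0.
Proof. exact: mcoeff0. Qed.

Lemma dcoefD f g d : dcoef (f + g) d = dcoef f d + dcoef g d.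
Proof. exact: mcoeffD. Qed.

Lemma dcoefZ (c : k) f d : dcoef (c *: f) d = c * dcoef f d.
Proof. exact: mcoeffZ. Qed.

Lemma dcoefU d e : dcoef (diU d) e = (d == e)%:R.
Proof. by rewrite diU.unlock; apply: mcoeffU. Qed.

Lemma mem_dsupp f d : (d \in dsupp f) = (dcoef f d != 0).
Proof. by rewrite /dcoef mcoeff_neq0. Qed.

Lemma dcoef_sum (I : Type) (r : seq I) (F : I -> Di k X) d :
  dcoef (\sum_(j <- r) F j) d = \sum_(j <- r) dcoef (F j) d.
Proof. by apply: (big_morph (dcoef^~ d)) => [f g|]; rewrite (dcoefD, dcoef0). Qed.

Lemma DiE f : f = \sum_(d <- dsupp f) dcoef f d *: diU d.
Proof.
apply/dcoefP => d; rewrite dcoef_sum.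
under eq_bigr do rewrite dcoefZ dcoefU.
have [df|] := boolP (d \in dsupp f); last first.
  move=> dNf; rewrite big1_seq => [|e /= ef].
    by move: dNf; rewrite mem_dsupp negbK => /eqP.
  by case: eqP ef => [->|]; rewrite ?(negPf dNf) ?mulr0.
rewrite (big_fsetD1 d) //= eqxx mulr1 big1_seq ?addr0 // => e /=.
by rewrite in_fsetD1 => /andP[/negPf-> _]; rewrite mulr0.
Qed.

Definition dimul (op : diword X -> diword X -> diword X) f g : Di k X :=
  \sum_(d <- dsupp f) \sum_(e <- dsupp g)
    (dcoef f d * dcoef g e) *: diU (op d e).

Section Dimul.
Variable op : diword X -> diword X -> diword X.

Lemma dimulw (d1 d2 : {fset diword X}) f g :
  (dsupp f `<=` d1)%fset -> (dsupp g `<=` d2)%fset ->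
  dimul op f g = \sum_(d <- d1) \sum_(e <- d2)
    (dcoef f d * dcoef g e) *: diU (op d e).
Proof.
move=> le_d1 le_d2; rewrite /dimul (big_fset_incl _ le_d1) /=.
  apply/eq_bigr=> d _; apply/big_fset_incl => // e _.
  by rewrite mem_dsupp negbK => /eqP->; rewrite mulr0 scale0r.
move=> d _; rewrite mem_dsupp negbK => /eqP fd.
by rewrite big1 => // e _; rewrite fd mul0r scale0r.
Qed.

Lemma dsuppZD (c : k) f g :
  (dsupp (c *: f + g)%R `<=` dsupp f `|` dsupp g)%fset.
Proof.
apply/fsubsetP => d; rewrite in_fsetU !mem_dsupp dcoefD dcoefZ.
by apply: contraNT; rewrite negb_or !negbK => /andP[/eqP-> /eqP->];
  rewrite mulr0 addr0.
Qed.

Lemma dimulPl (c : k) f f' g :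
  dimul op (c *: f + f') g = c *: dimul op f g + dimul op f' g.
Proof.
rewrite [dimul op f g](dimulw (fsubsetUl _ (dsupp f')) (fsubset_refl _)).
rewrite [dimul op f' g](dimulw (fsubsetUr (dsupp f) _) (fsubset_refl _)).
rewrite (dimulw (dsuppZD c f f') (fsubset_refl _)).
rewrite scaler_sumr -big_split /=; apply: eq_bigr => d _.
rewrite scaler_sumr -big_split /=; apply: eq_bigr => e _.
by rewrite dcoefD dcoefZ scalerA -scalerDl mulrDl mulrA.
Qed.

Lemma dimulPr (c : k) f g g' :
  dimul op f (c *: g + g') = c *: dimul op f g + dimul op f g'.
Proof.
rewrite [dimul op f g](dimulw (fsubset_refl _) (fsubsetUl _ (dsupp g'))).
rewrite [dimul op f g'](dimulw (fsubset_refl _) (fsubsetUr (dsupp g) _)).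
rewrite (dimulw (fsubset_refl _) (dsuppZD c g g')).
rewrite scaler_sumr -big_split /=; apply: eq_bigr => d _.
rewrite scaler_sumr -big_split /=; apply: eq_bigr => e _.
by rewrite dcoefD dcoefZ scalerA -scalerDl mulrDr mulrCA.
Qed.

Lemma dsuppU d : dsupp (diU d) = [fset d]%fset.
Proof.
apply/fsetP => e; rewrite mem_dsupp dcoefU in_fset1 [e == d]eq_sym.
by case: (d == e); rewrite ?oner_eq0 ?eqxx.
Qed.

Lemma dimulUU d e : dimul op (diU d) (diU e) = diU (op d e).
Proof.
by rewrite /dimul !dsuppU !big_seq_fset1 !dcoefU !eqxx mulr1 scale1r.
Qed.

Lemma dimul_linl g : linear (fun f => dimul op f g).
Proof. by move=> c f f'; apply: dimulPl. Qed.

Lemma dimul_linr f : linear (dimul op f).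
Proof. by move=> c g g'; apply: dimulPr. Qed.

End Dimul.

Lemma Di_ind (P : Di k X -> Prop) :
  P 0 -> (forall c d f, P f -> P (c *: diU d + f)) -> forall f, P f.
Proof.
move=> P0 PD f; rewrite (DiE f).
elim: (enum_fset (dsupp f)) => [|d r IH]; first by rewrite big_nil.
by rewrite big_cons; apply: PD.
Qed.

Lemma lin_ext (F G : Di k X -> Di k X) : linear F -> linear G ->
  (forall d, F (diU d) = G (diU d)) -> forall f, F f = G f.
Proof.
have lin0 (H : Di k X -> Di k X) : linear H -> H 0 = 0.
  by move=> lH; have := lH (-1) 0 0; rewrite scaler0 addr0 scaleN1r addNr.
move=> lF lG E; elim/Di_ind=> [|c d f IH]; first by rewrite !lin0.
by rewrite lF lG E IH.
Qed.

Definition trilinear (F : Di k X -> Di k X -> Di k X -> Di k X) : Prop :=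
  [/\ forall g h, linear (fun f => F f g h),
      forall f h, linear (fun g => F f g h)
    & forall f g, linear (F f g)].

Lemma trilin_ext (F G : Di k X -> Di k X -> Di k X -> Di k X) :
  trilinear F -> trilinear G ->
  (forall d e i, F (diU d) (diU e) (diU i) = G (diU d) (diU e) (diU i)) ->
  forall f g h, F f g h = G f g h.
Proof.
move=> [F1 F2 F3] [G1 G2 G3] E f g h.
apply: (lin_ext (F1 g h) (G1 g h)) => d.
apply: (lin_ext (F2 _ h) (G2 _ h)) => e.
exact: (lin_ext (F3 _ _) (G3 _ _)).
Qed.

Lemma dimul_trir (o1 o2 : diword X -> diword X -> diword X) :
  trilinear (fun f g h => dimul o1 f (dimul o2 g h)).
Proof.
split=> [g h c u v|f h c u v|f g c u v]; first exact: dimulPl.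
  by rewrite dimulPl dimulPr.
by rewrite dimulPr dimulPr.
Qed.

Lemma dimul_tril (o1 o2 : diword X -> diword X -> diword X) :
  trilinear (fun f g h => dimul o1 (dimul o2 f g) h).
Proof.
split=> [g h c u v|f h c u v|f g c u v]; last exact: dimulPr.
  by rewrite dimulPl dimulPl.
by rewrite dimulPr dimulPl.
Qed.

Lemma dimul3_eq (o1 o2 o3 o4 : diword X -> diword X -> diword X) :
  (forall d e i, o1 d (o2 e i) = o3 (o4 d e) i) ->
  forall f g h, dimul o1 f (dimul o2 g h) = dimul o3 (dimul o4 f g) h.
Proof.
move=> E; apply: (trilin_ext (dimul_trir o1 o2) (dimul_tril o3 o4)) => d e i.
by rewrite !dimulUU E.
Qed.

Lemma dimul3_eqr (o1 o2 o3 o4 : diword X -> diword X -> diword X) :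
  (forall d e i, o1 d (o2 e i) = o3 d (o4 e i)) ->
  forall f g h, dimul o1 f (dimul o2 g h) = dimul o3 f (dimul o4 g h).
Proof.
move=> E; apply: (trilin_ext (dimul_trir o1 o2) (dimul_trir o3 o4)) => d e i.
by rewrite !dimulUU E.
Qed.

Lemma dimul3_eql (o1 o2 o3 o4 : diword X -> diword X -> diword X) :
  (forall d e i, o1 (o2 d e) i = o3 (o4 d e) i) ->
  forall f g h, dimul o1 (dimul o2 f g) h = dimul o3 (dimul o4 f g) h.
Proof.
move=> E; apply: (trilin_ext (dimul_tril o1 o2) (dimul_tril o3 o4)) => d e i.
by rewrite !dimulUU E.
Qed.

Fact dw_vdashA : associative (@dw_vdash X).
Proof.
move=> d e i; apply: val_inj.
by rewrite /= /dpos /dword /= catA size_cat addnA.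
Qed.

Fact dw_dashvA : associative (@dw_dashv X).
Proof. by move=> d e i; apply: val_inj; rewrite /= /dpos /dword /= catA. Qed.

Fact dw_vdash_dashvA (d e i : diword X) :
  dw_vdash d (dw_dashv e i) = dw_dashv (dw_vdash d e) i.
Proof. by apply: val_inj; rewrite /= /dpos /dword /= catA. Qed.

Fact dw_dashv_vdash (d e i : diword X) :
  dw_dashv d (dw_vdash e i) = dw_dashv d (dw_dashv e i).
Proof. exact: val_inj. Qed.

Fact dw_vdash_dashv (d e i : diword X) :
  dw_vdash (dw_dashv d e) i = dw_vdash (dw_vdash d e) i.
Proof. exact: val_inj. Qed.

HB.instance Definition _ := Lmodule_isDialgebra.Build k (Di k X)
  (dimul_linl (@dw_vdash X)) (dimul_linr (@dw_vdash X))
  (dimul_linl (@dw_dashv X)) (dimul_linr (@dw_dashv X))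
  (dimul3_eq dw_vdashA) (dimul3_eq dw_dashvA)
  (dimul3_eqr dw_dashv_vdash) (dimul3_eql dw_vdash_dashv)
  (dimul3_eq dw_vdash_dashvA).

(* [u]_m as an element of Di<X>; the value 0 outside 1 <= m <= |u| is junk. *)
Definition diw (u : seq X) (m : nat) : Di k X :=
  if insub (u, m) is Some d then diU d else 0.

End FreeDialgebra.

Definition wordp {X : choiceType} : {pred seq X} := [pred u | u != [::]].

(* Words are ranged over by seq X; the value of lt on the empty word is
   irrelevant; lt u v reads u < v. *)
Record monomial_order {X : choiceType} (lt : rel (seq X)) : Prop := {
  mo_irr : {in wordp, irreflexive lt};
  mo_trans : {in wordp & &, transitive lt};
  mo_total : {in wordp &, forall u v, [|| u == v, lt u v | lt v u]};
  mo_wf : well_founded (fun u v => [&& u \in wordp, v \in wordp & lt u v]);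
  mo_mulr : {in wordp & &, forall u v w, lt v u -> lt (v ++ w) (u ++ w)};
  mo_mull : {in wordp & &, forall u v w, lt v u -> lt (w ++ v) (w ++ u)}
}.

Section Leading.
Context {k : fieldType} {X : choiceType}.
Variable lt : rel (seq X).
Implicit Types (f g h s : Di k X) (a b u : seq X) (d e : diword X).

Definition dlt : rel (diword X) := fun d e =>
  lt (dword d) (dword e) || (dword d == dword e) && (dpos d < dpos e)%N.

Definition dle : rel (diword X) := fun d e => (d == e) || dlt d e.

(* None stands for the 0 below all diwords. *)
Definition odle (o o' : option (diword X)) : bool :=
  match o, o' with
  | None, _ => true
  | Some _, None => false
  | Some d, Some e => dle d e
  end.

Definition lead f : option (diword X) :=
  ohead [seq d <- dsupp f | all (dle^~ d) (dsupp f)].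

(* [::] and 0 are the values at f = 0. *)
Definition lword f : seq X := if lead f is Some d then dword d else [::].
Definition lpos f : nat := if lead f is Some d then dpos d else 0%N.

Definition lc f : k := if lead f is Some d then dcoef f d else 0.
Definition lt_term f : Di k X :=
  if lead f is Some d then lc f *: diU d else 0.
Definition rest f : Di k X := f - lt_term f.

Definition dmonic f : bool := (f != 0) && (lc f == 1).

Definition strong f : bool :=
  (f != 0) && ((rest f == 0) || lt (lword (rest f)) (lword f)).

Definition posP a s b : pred nat := fun n =>
  (n == size a + lpos s)%N ||
  strong s && ((1 <= n <= size a)%N ||
               (size (a ++ lword s) < n <= size (a ++ lword s ++ b))%N).

(* Products with [a]_m or [b]_m in which an empty word is omitted. *)
Definition vdashl a m f := if a == [::] then f else diw a m ⊢ f.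
Definition dashvl a m f := if a == [::] then f else diw a m ⊣ f.
Definition vdashr f b m := if b == [::] then f else f ⊢ diw b m.
Definition dashvr f b m := if b == [::] then f else f ⊣ diw b m.

(* [asb]_l, meaningful for l \in posP a s b. *)
Definition nsd a s b (l : nat) : Di k X :=
  if (l <= size a)%N then dashvr (dashvl a l s) b 1
  else if l == (size a + lpos s)%N then dashvr (vdashl a (size a) s) b 1
  else vdashr (vdashl a (size a) s) b (l - size (a ++ lword s))%N.

Definition normal_diwords (S : set (Di k X)) : set (Di k X) :=
  [set h | exists a s b l, [/\ S s, l \in posP a s b & h = nsd a s b l]].

Inductive composition (S : set (Di k X)) : Di k X -> Prop :=
| Comp_left f x of S f & ~~ strong f :
    composition S (diw [:: x] 1 ⊣ f)
| Comp_right f u of S f & ~~ strong f & u \in wordp :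
    composition S (f ⊢ diw u (size u))
| Comp_incl f g a b of S f & S g & lword f = a ++ lword g ++ b
    & lpos f \in posP a g b :
    composition S (f - nsd a g b (lpos f))
| Comp_incl_left f g a b x of S f & S g & lword f = a ++ lword g ++ b
    & lpos f \notin posP a g b & strong f & strong g :
    composition S (nsd [:: x] f [::] 1 - nsd (x :: a) g b 1)
| Comp_incl_right f g a b x of S f & S g & lword f = a ++ lword g ++ b
    & lpos f \notin posP a g b & strong f & strong g :
    let n := size (lword f ++ [:: x]) in
    composition S (nsd [::] f [:: x] n - nsd a g (b ++ [:: x]) n)
| Comp_inter f g a b m of S f & S g & lword f ++ b = a ++ lword g
    & (size (lword f ++ b) < size (lword f) + size (lword g))%N
    & m \in posP [::] f b & m \in posP a g [::] :
    composition S (nsd [::] f b m - nsd a g [::] m)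
| Comp_inter_left f g a b x of S f & S g & lword f ++ b = a ++ lword g
    & (size (lword f ++ b) < size (lword f) + size (lword g))%N
    & (forall m, ~~ ((m \in posP [::] f b) && (m \in posP a g [::])))
    & strong f & strong g :
    composition S (nsd [:: x] f b 1 - nsd (x :: a) g [::] 1)
| Comp_inter_right f g a b x of S f & S g & lword f ++ b = a ++ lword g
    & (size (lword f ++ b) < size (lword f) + size (lword g))%N
    & (forall m, ~~ ((m \in posP [::] f b) && (m \in posP a g [::])))
    & strong f & strong g :
    let n := size ((lword f ++ b) ++ [:: x]) in
    composition S (nsd [::] f (b ++ [:: x]) n - nsd a g [:: x] n).

Definition trivial_mod (S : set (Di k X)) h : Prop :=
  exists2 r : seq (k * Di k X),
    forall p, p \in r -> normal_diwords S p.2 /\ odle (lead p.2) (lead h)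
  & h = \sum_(p <- r) p.1 *: p.2.

Definition GS_basis (S : set (Di k X)) : Prop :=
  forall h, composition S h -> trivial_mod S h.

Definition Irr (S : set (Di k X)) : set (diword X) :=
  [set d | forall h, normal_diwords S h -> Some d <> lead h].

End Leading.

Definition lin_basis {k : nzRingType} {V : lmodType k} (B : set V) : Prop :=
  (forall (r : seq V) (c : V -> k), uniq r -> (forall v, v \in r -> B v) ->
     \sum_(v <- r) c v *: v = 0 -> forall v, v \in r -> c v = 0) /\
  (forall w : V, exists (r : seq V) (c : V -> k),
     (forall v, v \in r -> B v) /\ w = \sum_(v <- r) c v *: v).

Definition Irr_basis {k : fieldType} {X : choiceType} (lt : rel (seq X))
    (S : set (Di k X)) : Prop :=
  let img (d : diword X) : dquot S := dpi S (diU d) in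
  (forall d e, Irr lt S d -> Irr lt S e -> img d = img e -> d = e) /\
  lin_basis (img @` Irr lt S).

(* Main.v *)
(* Write N_D for a normal S-diword with leading diword D; it is monic.  If the
   compositions of S are trivial, then
   - multiplying N_D by a diword gives a combination of normal S-diwords whose
     leading diwords are at most the expected one, so Id(S) is spanned by normal
     S-diwords;
   - N_D - N'_D is a combination of normal S-diwords with leading diwords < D:
     the two occurrences in the word of D are disjoint, nested or overlapping,
     and a composition settles the last two cases.
   In a combination of normal S-diwords all those with the maximal leading
   diword can thus be traded for a single one; by well-founded induction the
   leading diword of a nonzero element of Id(S) is that of a normal S-diword.
   Conversely this property lets every element of Id(S) be reduced to 0 by
   subtracting normal S-diwords, in particular every composition.  The same
   reduction modulo Id(S) rewrites any element on Irr(S), uniquely exactly when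
   no nonzero element of Id(S) has its leading diword in Irr(S). *)
Require Import Defs.
From mathcomp Require Import all_boot all_order all_algebra.
From mathcomp Require Import boolp classical_sets.
From HB Require Import structures.
From mathcomp Require Import finmap zify.

Local Open Scope ring_scope.

Set Implicit Arguments.
Unset Strict Implicit.
Unset Printing Implicit Defensive.

Import GRing.Theory.

(** * Linear spans, and identities in modules and words *)

Section LinearSpan.
Context {k : pzRingType}.

Inductive lspan {V : lmodType k} (G : V -> Prop) : V -> Prop :=
| lspan0 : lspan G 0
| lspan_cons c g f of G g & lspan G f : lspan G (c *: g + f).

Context {V : lmodType k}.
Implicit Types (G : V -> Prop) (f g : V).

Lemma lspan_gen G g : G g -> lspan G g.
Proof.
by move=> Gg; rewrite -[g]scale1r -[_ *: g]addr0; apply/lspan_cons/lspan0.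
Qed.

Lemma lspanD G f g : lspan G f -> lspan G g -> lspan G (f + g).
Proof.
move=> Gf Gg; elim: Gf => [|c h f' Gh _ IH]; first by rewrite add0r.
by rewrite -addrA; apply: lspan_cons.
Qed.

Lemma lspanZ G c f : lspan G f -> lspan G (c *: f).
Proof.
elim=> [|c' h f' Gh _ IH]; first by rewrite scaler0; apply: lspan0.
by rewrite scalerDr scalerA; apply: lspan_cons.
Qed.

Lemma lspanB G f g : lspan G f -> lspan G g -> lspan G (f - g).
Proof. move=> Gf Gg; rewrite -scaleN1r; exact: (lspanD Gf (lspanZ _ Gg)). Qed.

Lemma lspan_sum G (I : eqType) (r : seq I) (F : I -> V) :
  (forall i, i \in r -> lspan G (F i)) -> lspan G (\sum_(i <- r) F i).
Proof.
by move=> GF; rewrite big_seq; elim/big_ind: _ => //;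
  [apply: lspan0 | move=> *; apply: lspanD].
Qed.

End LinearSpan.

Lemma lspan_linear (k : pzRingType) (V W : lmodType k) (G : V -> Prop)
    (H : W -> Prop) (F : {linear V -> W}) f :
  (forall g, G g -> lspan H (F g)) -> lspan G f -> lspan H (F f).
Proof.
move=> GH; elim=> [|c g f' Gg _ IH]; first by rewrite linear0; apply: lspan0.
by rewrite linearP; apply: (lspanD _ IH); apply/lspanZ/GH.
Qed.

Lemma lspan_mono (k : pzRingType) (V : lmodType k) (G H : V -> Prop) f :
  (forall g, G g -> H g) -> lspan G f -> lspan H f.
Proof.
by move=> GH; elim=> [|c g f' Gg _]; [exact: lspan0|apply/lspan_cons/GH].
Qed.

Lemma lspan_seq (k : pzRingType) (V : lmodType k) (G : V -> Prop) f :
  lspan G f <-> exists2 r : seq (k * V),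
    forall p, p \in r -> G p.2 & f = \sum_(p <- r) p.1 *: p.2.
Proof.
split=> [|[r Gr ->]]; last first.
  by apply: lspan_sum => p pr; apply/lspanZ/lspan_gen/Gr.
elim=> [|c g f' Gg _ [r Gr ->]]; first by exists [::]; rewrite ?big_nil.
exists ((c, g) :: r); last by rewrite big_cons.
by move=> p /predU1P[->//|/Gr].
Qed.

Lemma subr_common (V : zmodType) (x y z : V) : x - y = (x - z) - (y - z).
Proof. by rewrite opprB addrA subrK. Qed.

Lemma subr_subr (V : zmodType) (x y z : V) : y + z = x - ((x - y) - z).
Proof. by rewrite opprB addrCA opprB [x + _]addrC subrK; apply: addrC. Qed.

(** The exchange step: in a combination the generator [g] is traded for [g0] at the cost of the
    difference [g - g0]. *)
Lemma scaler_swap (R : pzRingType) (V : lmodType R) (c c0 : R) (f g g0 : V) :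
  c *: g + f - (c + c0) *: g0 = c *: (g - g0) + (f - c0 *: g0).
Proof. by rewrite scalerBr scalerDl opprD addrACA. Qed.

Lemma dpi_sum (k : pzRingType) (D : dialgType k) (S : set D) (I : Type)
    (r : seq I) (c : I -> k) (F : I -> D) :
  dpi S (\sum_(i <- r) c i *: F i) = \sum_(i <- r) c i *: dpi S (F i).
Proof. by rewrite linear_sum; apply: eq_bigr => i _; rewrite linearZ. Qed.

Lemma dpi_eq0 (k : pzRingType) (D : dialgType k) (S : set D) f :
  dpi S f = 0 <-> Id S f.
Proof. by rewrite -(linear0 (dpi S)) dpiP subr0. Qed.

(** Levi's lemma; it locates two occurrences in the same word relative to each other. *)
Lemma cat_eq_split (T : eqType) (s1 s2 t1 t2 : seq T) :
  s1 ++ t1 = s2 ++ t2 -> (size s1 <= size s2)%N ->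
  exists2 c, s2 = s1 ++ c & t1 = c ++ t2.
Proof.
elim: s1 s2 => [|x s1 IH] [|y s2] //=; try by [exists [::]].
  by move=> ->; exists (y :: s2).
by case=> -> /IH h /h[c -> ->]; exists c.
Qed.

(** * Two-sided multiplication by words *)

(* For a diword f, [InL n], [InM], [InR n] place the center of afb at the n-th
   letter of a, at the center of f, at the n-th letter of b. *)
Inductive center := InL of nat | InM | InR of nat.

(* The center M of A(afb)B, with afb centered at m, as a center of (Aa)f(bB);
   the first two arguments are the lengths of A and b. *)
Definition comp_center (A b : nat) (M m : center) : center :=
  match M, m with
  | InL n, _ => InL n
  | InR n, _ => InR (b + n)
  | InM, InL n => InL (A + n)
  | InM, _ => m
  end.

Section Frame.
Context {k : fieldType} {X : choiceType}.
Implicit Types (f g : Di k X) (a b u v w : seq X) (d e : diword X).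

Lemma diw_diword d : diw (dword d) (dpos d) = diU d :> Di k X.
Proof.
rewrite /diw; case: insubP => [e _ /= E|]; last first.
  by rewrite -surjective_pairing (valP d).
by congr diU; apply: val_inj; rewrite [LHS]E [RHS]surjective_pairing.
Qed.

Lemma diword_bounds d : (1 <= dpos d <= size (dword d))%N.
Proof. exact: valP d. Qed.

Lemma diword_neq0 d : dword d != [::].
Proof. by have := diword_bounds d; case: (dword d) => //=; lia. Qed.

Definition mkdiword u n (h : (1 <= n <= size u)%N) : diword X :=
  exist _ (u, n) h.

Lemma diwE u n (h : (1 <= n <= size u)%N) :
  diw u n = diU (mkdiword h) :> Di k X.
Proof. by rewrite -diw_diword. Qed.

Definition lmap (F : diword X -> Di k X) f : Di k X :=
  \sum_(d <- dsupp f) dcoef f d *: F d.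

Lemma lmapw F f (D : {fset diword X}) : (dsupp f `<=` D)%fset ->
  lmap F f = \sum_(d <- D) dcoef f d *: F d.
Proof.
move=> fD; apply/big_fset_incl => // d _.
by rewrite mem_dsupp negbK => /eqP->; rewrite scale0r.
Qed.

Lemma lmap_is_linear F : linear (lmap F).
Proof.
move=> c f g; rewrite (lmapw _ (dsuppZD c f g)).
rewrite (lmapw _ (fsubsetUl _ (dsupp g))) (lmapw _ (fsubsetUr (dsupp f) _)).
rewrite scaler_sumr -big_split; apply: eq_bigr => d _ /=.
by rewrite dcoefD dcoefZ scalerDl scalerA.
Qed.

Lemma lmapU F d : lmap F (diU d) = F d.
Proof. by rewrite /lmap dsuppU big_seq_fset1 dcoefU eqxx scale1r. Qed.

(** The terms of an element have different lengths, so a center to the right of the middle factor is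
    counted from the end of that factor; one center then serves all terms. *)
Definition cpos a (m : center) u (p : nat) : nat :=
  match m with
  | InL n => n
  | InM => size a + p
  | InR n => size a + size u + n
  end%N.

Definition placeable a b (m : center) : bool :=
  match m with
  | InL n => 1 <= n <= size a
  | InM => true
  | InR n => 1 <= n <= size b
  end%N.

(** All three shapes of normal S-diwords, and all products of an element by a diword, are values of
    this one linear map. *)
Definition frame a b (m : center) : Di k X -> Di k X :=
  lmap (fun d => diw (a ++ dword d ++ b) (cpos a m (dword d) (dpos d))).

Lemma frame_is_linear a b m : linear (frame a b m).
Proof. exact: lmap_is_linear. Qed.
HB.instance Definition _ a b m :=
  GRing.isLinear.Build k (Di k X) (Di k X) *:%R (frame a b m)
    (frame_is_linear a b m).

Lemma cpos_bounds a b m u p : placeable a b m -> (1 <= p <= size u)%N ->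
  (1 <= cpos a m u p <= size (a ++ u ++ b))%N.
Proof. by case: m => [n||n] /=; rewrite !size_cat; lia. Qed.

Lemma frameU a b m d :
  frame a b m (diU d) = diw (a ++ dword d ++ b) (cpos a m (dword d) (dpos d)).
Proof. exact: lmapU. Qed.

Lemma frame_diw a b m u p : (1 <= p <= size u)%N ->
  frame a b m (diw u p) = diw (a ++ u ++ b) (cpos a m u p).
Proof. by move=> h; rewrite diwE frameU. Qed.

(** Stands in for the dialgebra axioms in the sequel: the outer center wins unless it lies on the
    middle factor. By linearity it suffices to compare positions on diwords. *)
Lemma frame_frame A B M a b m f : placeable a b m ->
  frame A B M (frame a b m f) =
    frame (A ++ a) (b ++ B) (comp_center (size A) (size b) M m) f.
Proof.
move=> abm; apply: (@lin_ext _ _ (fun f => frame A B M (frame a b m f))).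
- by move=> c g h; rewrite !linearP.
- exact: frame_is_linear.
move=> d; have db := diword_bounds d; rewrite !frameU frame_diw ?cpos_bounds //.
rewrite -!catA; congr diw.
by case: M; case: m abm => //=; rewrite !size_cat; lia.
Qed.

Lemma placeable_comp A B M a b m : placeable A B M -> placeable a b m ->
  placeable (A ++ a) (b ++ B) (comp_center (size A) (size b) M m).
Proof. by case: M; case: m => //=; rewrite ?size_cat; lia. Qed.

Lemma cpos_comp A M a b m u p : placeable a b m ->
  cpos (A ++ a) (comp_center (size A) (size b) M m) u p =
    cpos A M (a ++ u ++ b) (cpos a m u p).
Proof. by case: M; case: m => //=; rewrite ?size_cat; lia. Qed.

Lemma frame_nil f : frame [::] [::] InM f = f.
Proof.
apply: (@lin_ext _ _ _ id) => //; first exact: frame_is_linear.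
by move=> d; rewrite frameU cats0 diw_diword.
Qed.

Lemma diw_dashv_frame a n f : (1 <= n <= size a)%N ->
  diw a n ⊣ f = frame a [::] (InL n) f.
Proof.
move=> an; apply: lin_ext => [||d]; [exact: dashv_linr|exact: frame_is_linear|].
rewrite frameU (diwE an) [LHS]dimulUU -diw_diword cats0.
by rewrite /dw_dashv /dword /dpos.
Qed.

Lemma diw_vdash_frame a n f : (1 <= n <= size a)%N ->
  diw a n ⊢ f = frame a [::] InM f.
Proof.
move=> an; apply: lin_ext => [||d]; [exact: vdash_linr|exact: frame_is_linear|].
rewrite frameU (diwE an) [LHS]dimulUU -diw_diword cats0.
by rewrite /dw_vdash /dword /dpos.
Qed.

Lemma dashv_diw_frame b n f : (1 <= n <= size b)%N ->
  f ⊣ diw b n = frame [::] b InM f.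
Proof.
move=> bn; apply: (@lin_ext _ _ (fun f => f ⊣ diw b n)) => [||d].
- exact: dashv_linl.
- exact: frame_is_linear.
rewrite frameU (diwE bn) [LHS]dimulUU -diw_diword.
by rewrite /dw_dashv /dword /dpos.
Qed.

Lemma vdash_diw_frame b n f : (1 <= n <= size b)%N ->
  f ⊢ diw b n = frame [::] b (InR n) f.
Proof.
move=> bn; apply: (@lin_ext _ _ (fun f => f ⊢ diw b n)) => [||d].
- exact: vdash_linl.
- exact: frame_is_linear.
rewrite frameU (diwE bn) [LHS]dimulUU -diw_diword.
by rewrite /dw_vdash /dword /dpos.
Qed.

Lemma dashvr_frame f b : dashvr f b 1 = frame [::] b InM f.
Proof.
rewrite /dashvr; case: eqP => [->|b0]; first by rewrite frame_nil.
by rewrite dashv_diw_frame //; case: b b0.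
Qed.

Lemma vdashl_frame a f : vdashl a (size a) f = frame a [::] InM f.
Proof.
rewrite /vdashl; case: eqP => [->|a0]; first by rewrite frame_nil.
by rewrite diw_vdash_frame //; case: a a0 => //= *; lia.
Qed.

Context (lt : rel (seq X)).

(** The tests of [nsd] on the position recover [m], because the bounds on [lpos] keep the three
    ranges of positions disjoint. *)
Lemma nsd_frame a b m f : placeable a b m ->
  (1 <= lpos lt f <= size (lword lt f))%N ->
  nsd lt a f b (cpos a m (lword lt f) (lpos lt f)) = frame a b m f.
Proof.
move=> + hp; case: m => [n||n] /= abm; rewrite /nsd !size_cat.
- have [-> a0] : (n <= size a)%N /\ (a != [::]) by case: a abm => //=; lia.
  rewrite dashvr_frame /dashvl (negPf a0).
  rewrite (diw_dashv_frame _ abm).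
  rewrite (frame_frame _ _ _ _ (abm : placeable a [::] (InL n))).
  by rewrite cat0s.
- rewrite ifF ?eqxx; last lia.
  rewrite dashvr_frame vdashl_frame.
  by rewrite (frame_frame _ _ _ _ (isT : placeable a [::] InM)).
rewrite ifF ?ifF; try lia.
rewrite addKn /vdashr ifF; last by case: b abm => //=; lia.
rewrite vdashl_frame (vdash_diw_frame _ abm).
by rewrite (frame_frame _ _ _ _ (isT : placeable a [::] InM)).
Qed.

Lemma posP_cpos a b f l : (1 <= lpos lt f <= size (lword lt f))%N ->
  l \in posP lt a f b <->
  exists m, [/\ placeable a b m, m = InM \/ strong lt f
              & l = cpos a m (lword lt f) (lpos lt f)].
Proof.
move=> hp; rewrite unfold_in /posP !size_cat; split.
  case: eqP => [-> _|_ /= /andP[sf /orP[h|h]]].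
  - by exists InM; split=> //; left.
  - by exists (InL l); split=> //; right.
  exists (InR (l - (size a + size (lword lt f)))).
  by split=> /=; [lia|right|lia].
move=> [[n||n] /= [abm + ->]]; rewrite ?eqxx // => -[//|->].
  by rewrite /= abm orbT.
by apply/orP; right; apply/orP; right; lia.
Qed.

End Frame.

(** * Bounds on the support *)

Section Bounds.
Context {k : fieldType} {X : choiceType}.
Implicit Types (f g : Di k X) (d e : diword X) (Q : diword X -> Prop).

Lemma diword_inj d e : dword d = dword e -> dpos d = dpos e -> d = e.
Proof.
rewrite /dword /dpos => E1 E2; apply: val_inj.
by rewrite [LHS]surjective_pairing [RHS]surjective_pairing E1 E2.
Qed.

(* The default value d is irrelevant under [placeable a b m]. *)
Definition dframe (a b : seq X) (m : center) d : diword X :=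
  insubd d (a ++ dword d ++ b, cpos a m (dword d) (dpos d)).

Lemma val_dframe a b m d : placeable a b m ->
  val (dframe a b m d) = (a ++ dword d ++ b, cpos a m (dword d) (dpos d)).
Proof. by move=> h; rewrite val_insubd cpos_bounds ?diword_bounds. Qed.

Lemma dword_dframe a b m d : placeable a b m ->
  dword (dframe a b m d) = a ++ dword d ++ b.
Proof. by move=> h; rewrite /dword val_dframe. Qed.

Lemma dpos_dframe a b m d : placeable a b m ->
  dpos (dframe a b m d) = cpos a m (dword d) (dpos d).
Proof. by move=> h; rewrite /dpos val_dframe. Qed.

Lemma frame_diU a b m d : placeable a b m ->
  frame a b m (diU d) = diU (dframe a b m d) :> Di k X.
Proof. by move=> h; rewrite frameU -diw_diword dword_dframe ?dpos_dframe. Qed.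

Lemma dframe_dframe A B M a b m d : placeable A B M -> placeable a b m ->
  dframe A B M (dframe a b m d) =
    dframe (A ++ a) (b ++ B) (comp_center (size A) (size b) M m) d.
Proof.
move=> hM hm; have hc := placeable_comp hM hm.
apply: diword_inj.
  rewrite (dword_dframe _ hM) (dword_dframe _ hc) dword_dframe //.
  by rewrite -!catA.
by rewrite !dpos_dframe // dword_dframe // cpos_comp.
Qed.

Lemma cat_diword_neq0 (a b : seq X) d : a ++ dword d ++ b != [::].
Proof. by case: a => //=; case: (dword d) (diword_neq0 d). Qed.

Definition suppb Q f : Prop := forall d, dcoef f d != 0 -> Q d.

Lemma suppb_mono Q Q' f : (forall d, Q d -> Q' d) -> suppb Q f -> suppb Q' f.
Proof. by move=> QQ' fQ d /fQ/QQ'. Qed.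

Lemma suppb0 Q : suppb Q (0 : Di k X).
Proof. by move=> d; rewrite dcoef0 eqxx. Qed.

Lemma suppbU Q d : Q d -> suppb Q (diU d : Di k X).
Proof.
by move=> Qd e; rewrite dcoefU; case: (d =P e) => [<-|]; rewrite ?eqxx.
Qed.

Lemma suppb_lin Q c f g : suppb Q f -> suppb Q g -> suppb Q (c *: f + g).
Proof.
move=> fQ gQ d; rewrite dcoefD dcoefZ.
have [/fQ//|] := boolP (dcoef f d != 0); rewrite negbK => /eqP->.
by rewrite mulr0 add0r => /gQ.
Qed.

Lemma suppbZ Q c f : suppb Q f -> suppb Q (c *: f).
Proof.
by move=> fQ; have := suppb_lin (c := c) fQ (@suppb0 Q); rewrite addr0.
Qed.

Lemma suppbD Q f g : suppb Q f -> suppb Q g -> suppb Q (f + g).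
Proof. by rewrite -[f in f + g]scale1r; apply: suppb_lin. Qed.

Lemma suppbB Q f g : suppb Q f -> suppb Q g -> suppb Q (f - g).
Proof. by move=> fQ gQ; rewrite addrC -scaleN1r; apply: suppb_lin. Qed.

Lemma suppb_sum Q (I : eqType) (r : seq I) (F : I -> Di k X) :
  (forall i, i \in r -> suppb Q (F i)) -> suppb Q (\sum_(i <- r) F i).
Proof.
by move=> QF; rewrite big_seq; elim/big_ind: _ => //;
  [apply: suppb0 | move=> *; apply: suppbD].
Qed.

Lemma suppb_frame Q Q' a b m f : placeable a b m ->
  (forall d, Q d -> Q' (dframe a b m d)) ->
  suppb Q f -> suppb Q' (frame a b m f).
Proof.
move=> abm QQ' fQ; rewrite /frame /lmap; apply: suppb_sum => d.
rewrite mem_dsupp => /fQ/QQ' Qd; apply: suppbZ.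
by rewrite -[diw _ _]frameU frame_diU //; apply: suppbU.
Qed.

End Bounds.

(** * The monomial-center ordering and leading diwords *)

Section Order.
Context {X : choiceType} {lt : rel (seq X)} (lt_mo : monomial_order lt).
Implicit Types (d e i : diword X) (u v a b : seq X).

Lemma mo_cat a b u v : u != [::] -> v != [::] -> lt u v ->
  lt (a ++ u ++ b) (a ++ v ++ b).
Proof.
move=> u0 v0 uv.
have uvb : lt (u ++ b) (v ++ b).
  by case: b => [|x b]; rewrite ?cats0 //; apply: (mo_mulr lt_mo).
case: a => [|x a] //; apply: (mo_mull lt_mo) => //.
  by rewrite inE; case: (v) v0.
by rewrite inE; case: (u) u0.
Qed.

Lemma dlt_irr d : dlt lt d d = false.
Proof. by rewrite /dlt (mo_irr lt_mo (diword_neq0 d)) ltnn andbF. Qed.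

Lemma dlt_word_trans d e i : lt (dword d) (dword e) -> lt (dword e) (dword i) ->
  lt (dword d) (dword i).
Proof.
exact: (mo_trans lt_mo (diword_neq0 e) (diword_neq0 d) (diword_neq0 i)).
Qed.

Lemma dlt_trans d e i : dlt lt d e -> dlt lt e i -> dlt lt d i.
Proof.
rewrite /dlt => /orP[h1|/andP[/eqP E1 h1]] /orP[h2|/andP[/eqP E2 h2]].
- by rewrite (dlt_word_trans h1 h2).
- by rewrite -E2 h1.
- by rewrite E1 h2.
by rewrite E1 E2 eqxx (ltn_trans h1 h2) orbT.
Qed.

Lemma dle_refl d : dle lt d d.
Proof. by rewrite /dle eqxx. Qed.

Lemma dltW d e : dlt lt d e -> dle lt d e.
Proof. by rewrite /dle => ->; rewrite orbT. Qed.

Lemma dle_dlt_trans d e i : dle lt d e -> dlt lt e i -> dlt lt d i.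
Proof. by case/predU1P=> [->|/dlt_trans]; last apply. Qed.

Lemma dlt_dle_trans d e i : dlt lt d e -> dle lt e i -> dlt lt d i.
Proof. by move=> de /predU1P[<-//|]; apply: dlt_trans. Qed.

Lemma dle_trans d e i : dle lt d e -> dle lt e i -> dle lt d i.
Proof. by move=> de /predU1P[<-//|ei]; apply/dltW/(dle_dlt_trans de). Qed.

Lemma dle_total d e : dle lt d e \/ dlt lt e d.
Proof.
have/or3P[/eqP E|h|h] := mo_total lt_mo (diword_neq0 d) (diword_neq0 e).
- have [h|h|h] := ltngtP (dpos d) (dpos e).
  + by left; rewrite /dle /dlt E eqxx h !orbT.
  + by right; rewrite /dlt E eqxx h orbT.
  by left; rewrite (diword_inj E h) dle_refl.
- by left; rewrite /dle /dlt h orbT.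
by right; rewrite /dlt h.
Qed.

Lemma dle_anti d e : dle lt d e -> dle lt e d -> d = e.
Proof.
move=> /predU1P[//|h] /(dlt_dle_trans h); by rewrite dlt_irr.
Qed.

Lemma dleE d e :
  dle lt d e =
    lt (dword d) (dword e) || (dword d == dword e) && (dpos d <= dpos e)%N.
Proof.
rewrite /dle /dlt; case: (lt _ _); rewrite ?orbT //= [(dpos d <= _)%N]leq_eqVlt.
case: (dword d =P dword e) => [E|nE] /=; last first.
  by case: eqP => // E; rewrite E in nE.
by congr orb; apply/eqP/eqP => [->//|]; apply: diword_inj.
Qed.

Lemma dlt_wf : well_founded (dlt lt).
Proof.
suff h u : forall d, dword d = u -> Acc (dlt lt) d by move=> d; apply: h.
elim/(well_founded_ind (mo_wf lt_mo)): u => u IHu d.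
move: {2}(dpos d) (erefl (dpos d)) => n.
elim/ltn_ind: n d => n IHn d En Eu; constructor=> e /orP[h|/andP[/eqP Ew h]].
  by apply: (IHu (dword e)); rewrite // -Eu !inE !diword_neq0.
by apply: (IHn (dpos e)); rewrite -?En // Ew.
Qed.

(** A center outside the middle factor forgets the positions of [d] and [e], so strictness then
    requires the words themselves to differ. This is what strong elements provide. *)
Lemma dlt_dframe a b m d e : placeable a b m ->
  m = InM \/ lt (dword d) (dword e) -> dlt lt d e ->
  dlt lt (dframe a b m d) (dframe a b m e).
Proof.
move=> abm hm; rewrite /dlt !dword_dframe // !dpos_dframe // => h.
have [l|nl] := boolP (lt (dword d) (dword e)).
  by rewrite mo_cat ?diword_neq0.
move: h; rewrite (negPf nl) => /= /andP[/eqP -> h].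
by case: hm => [->|]; rewrite ?(negPf nl) //= eqxx ltn_add2l h orbT.
Qed.

Lemma dlt_dframe_word a b m d e : placeable a b m ->
  lt (dword d) (dword e) -> dlt lt (dframe a b m d) (dframe a b m e).
Proof. by move=> abm h; apply: dlt_dframe => //; [right|rewrite /dlt h]. Qed.

(** Forgetting positions turns a comparison between equal words at worst into an equality, so the
    weak bound passes through every center. *)
Lemma dle_dframe a b m d e : placeable a b m -> dle lt d e ->
  dle lt (dframe a b m d) (dframe a b m e).
Proof.
move=> abm; rewrite !dleE !dword_dframe // !dpos_dframe //.
have [l|nl] := boolP (lt (dword d) (dword e)).
  by rewrite mo_cat ?diword_neq0.
move=> /= /andP[/eqP -> h]; rewrite eqxx; apply/orP; right.
by case: (m) => [n||n] //=; rewrite leq_add2l.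
Qed.

Context {k : fieldType}.
Implicit Types (f g h : Di k X).

(** Antisymmetry leaves at most one maximal element in the support, so the head of the filtered
    enumeration does not depend on the enumeration. *)
Lemma leadP f d :
  lead lt f = Some d <-> dcoef f d != 0 /\ suppb (fun e => dle lt e d) f.
Proof.
have maxP e : (e \in [seq d <- dsupp f | all (dle lt ^~ d) (dsupp f)]) <->
    dcoef f e != 0 /\ suppb (fun e' => dle lt e' e) f.
  rewrite mem_filter mem_dsupp; split=> [/andP[/allP h ->]|[-> h]].
    by split=> // e'; rewrite -mem_dsupp => /h.
  by rewrite andbT; apply/allP => e'; rewrite mem_dsupp => /h.
rewrite /lead; move: maxP; case: filter => [|e r] maxP /=.
  by split=> // /maxP; rewrite in_nil.
have [he1 he2] := (maxP e).1 (mem_head _ _).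
split=> [[<-]//|[hd1 hd2]]; congr Some.
by apply: dle_anti; [apply: hd2|apply: he2].
Qed.

Lemma lead_ex f : f != 0 -> exists d, lead lt f = Some d.
Proof.
move=> f0.
have /fset0Pn[d0 d0f] : dsupp f != fset0.
  apply: contraNneq f0 => E; apply/eqP/dcoefP => d; rewrite dcoef0; apply/eqP.
  by have := mem_dsupp f d; rewrite E in_fset0 => /esym/negbFE.
have [d dr hd] : exists2 d, d \in (dsupp f : seq _) &
    forall e, e \in (dsupp f : seq _) -> dle lt e d.
  move: d0f; rewrite -[_ \in _]/(d0 \in (dsupp f : seq _)).
  elim: (dsupp f : seq _) d0 => // d1 r IH d0 _.
  case: r IH => [_|d2 r /(_ d2 (mem_head _ _)) [d dr hd]].
    exists d1; rewrite ?mem_head // => e; rewrite inE => /eqP->.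
    exact: dle_refl.
  have [h|h] := dle_total d1 d.
    by exists d => [|e]; [rewrite in_cons dr orbT | case/predU1P=> [->|/hd]].
  exists d1; rewrite ?mem_head // => e /predU1P[->|/hd he].
    exact: dle_refl.
  exact/dltW/(dle_dlt_trans he).
exists d; apply/leadP; split; first by rewrite -mem_dsupp.
by move=> e; rewrite -mem_dsupp; apply: hd.
Qed.

Lemma lead_None f : lead lt f = None -> f = 0.
Proof. by move=> fN; apply/eqP; apply: contraPT fN => /lead_ex[d ->]. Qed.

Lemma lead_neq0 f d : lead lt f = Some d -> f != 0.
Proof. by move/leadP => [fd _]; apply: contraNneq fd => ->; rewrite dcoef0. Qed.

(** Turns a strict bound into a weak bound at a smaller diword, the form that well-founded induction
    consumes. *)
Lemma suppb_dltP f d : suppb (fun e => dlt lt e d) f ->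
  f = 0 \/ exists2 e, dlt lt e d & suppb (fun i => dle lt i e) f.
Proof.
have [->|/lead_ex[e /leadP[fe hf]]] := eqVneq f 0; first by left.
by move=> /(_ e fe) ed; right; exists e.
Qed.

Lemma lead_unitri f d :
  suppb (fun e => dlt lt e d) (f - diU d) ->
  lead lt f = Some d /\ dcoef f d = 1.
Proof.
have -> : dcoef f d = dcoef (f - diU d) d + 1.
  by rewrite dcoefD -scaleN1r dcoefZ dcoefU eqxx mulr1 subrK.
move=> h; have fd0 : dcoef (f - diU d) d = 0.
  by apply/eqP; apply: contraFT (dlt_irr d) => /h.
split; last by rewrite fd0 add0r.
apply/leadP; split.
  rewrite -(subrK (diU d) f) dcoefD fd0 add0r dcoefU eqxx; exact: oner_neq0.
rewrite -[f](subrK (diU d)); apply: suppbD; last exact: (suppbU (dle_refl d)).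
by apply: suppb_mono h => e; apply: dltW.
Qed.

(** For a monic [f] the rest is [f - diU d]; strength improves its bound from diwords to associative
    words. *)
Lemma dmonicP f : dmonic lt f ->
  exists2 d, lead lt f = Some d & suppb (fun e => dlt lt e d) (f - diU d) /\
    (strong lt f -> suppb (fun e => lt (dword e) (dword d)) (f - diU d)).
Proof.
case/andP=> f0; have [d Ed] := lead_ex f0.
rewrite /strong /rest /lt_term /lword /lc Ed f0 /= => /eqP fd1.
exists d => //; rewrite fd1 scale1r; have [_ hf] := (leadP f d).1 Ed.
split.
  move=> e; rewrite dcoefD -scaleN1r dcoefZ dcoefU.
  have [<-|ne] := eqVneq d e; first by rewrite fd1 mulr1 subrr eqxx.
  by rewrite mulr0 addr0 => /hf /predU1P[] // E; rewrite E eqxx in ne.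
case/orP=> [/eqP ->|]; first exact: suppb0.
case E: (lead lt (f - diU d)) => [i|].
  have [_ hi] := (leadP _ _).1 E => h e /hi; rewrite dleE => /orP[h'|].
    exact: dlt_word_trans h' h.
  by case/andP=> /eqP-> _.
by rewrite (lead_None E) => _; apply: suppb0.
Qed.

End Order.

(** * Normal S-diwords *)

Section Normal.
Context {k : fieldType} {X : choiceType} {lt : rel (seq X)}.
Context (lt_mo : monomial_order lt) {S : set (Di k X)}.
Context (S_monic : forall s, S s -> dmonic lt s).
Implicit Types (f g h s : Di k X) (d e : diword X) (a b c : seq X).
Implicit Types Q : diword X -> Prop.

(** Together with [placeable] this expresses $l\in P([asb])$ in terms of centers, by [posP_cpos]. *)
Definition center_ok (m : center) s : Prop := m = InM \/ strong lt s.

(** The index is the leading diword, by [normal_lead], so that bounds on a combination are bounds on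
    indices. *)
Inductive normal : diword X -> Di k X -> Prop :=
| Normal a b m s d of S s & placeable a b m & center_ok m s
    & lead lt s = Some d : normal (dframe a b m d) (frame a b m s).

Definition nspan Q : Di k X -> Prop :=
  lspan (fun g => exists2 d, Q d & normal d g).

Lemma nspan_mono Q Q' f : (forall d, Q d -> Q' d) -> nspan Q f -> nspan Q' f.
Proof. by move=> QQ'; apply: lspan_mono => g [d /QQ' Qd ng]; exists d. Qed.

Lemma normal_nspan Q d g : Q d -> normal d g -> nspan Q g.
Proof. by move=> Qd ng; apply: lspan_gen; exists d. Qed.

Lemma frame_nspan a b m s d : S s -> placeable a b m -> center_ok m s ->
  lead lt s = Some d ->
  nspan (fun e => dle lt e (dframe a b m d)) (frame a b m s).
Proof.
move=> Ss abm hm sd; apply: (normal_nspan (d := dframe a b m d)).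
  exact: dle_refl.
exact: Normal.
Qed.

Lemma leading_rest s d : S s -> lead lt s = Some d ->
  suppb (fun e => dlt lt e d) (s - diU d) /\
  (strong lt s -> suppb (fun e => lt (dword e) (dword d)) (s - diU d)).
Proof. by move=> /S_monic/(dmonicP lt_mo)[e -> h] [<-]. Qed.

(** With the center on [s], multiplication is strictly monotone on diwords. Otherwise [s] is strong
    and the words of its rest are already smaller. *)
Lemma frame_rest a b m s d : S s -> placeable a b m -> center_ok m s ->
  lead lt s = Some d ->
  suppb (fun e => dlt lt e (dframe a b m d))
    (frame a b m s - diU (dframe a b m d)).
Proof.
move=> Ss abm hm sd; have [h hs] := leading_rest Ss sd.
rewrite -frame_diU // -linearB.
case: hm => [E|/hs {}hs].
  apply: suppb_frame h => // e ed; apply: dlt_dframe => //; by left.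
by apply: suppb_frame hs => // e ed; apply: dlt_dframe_word.
Qed.

Lemma frame_rest_word a b m s d : S s -> placeable a b m -> strong lt s ->
  lead lt s = Some d ->
  suppb (fun e => lt (dword e) (a ++ dword d ++ b))
    (frame a b m s - diU (dframe a b m d)).
Proof.
move=> Ss abm hm sd; have [_ /(_ hm) h] := leading_rest Ss sd.
rewrite -frame_diU // -linearB; apply: suppb_frame h => // e ed.
by rewrite dword_dframe //; apply: mo_cat; rewrite ?diword_neq0.
Qed.

Lemma normal_lead d g : normal d g -> lead lt g = Some d /\ dcoef g d = 1.
Proof.
by case=> a b m s {}d Ss abm hm sd; apply/lead_unitri => //; apply: frame_rest.
Qed.

Lemma lead_lpos s d : lead lt s = Some d ->
  lword lt s = dword d /\ lpos lt s = dpos d.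
Proof. by rewrite /lword /lpos => ->. Qed.

Lemma lpos_bounds s : S s -> (1 <= lpos lt s <= size (lword lt s))%N.
Proof.
move=> /S_monic/(dmonicP lt_mo)[d /lead_lpos[-> ->] _]; exact: diword_bounds.
Qed.

Lemma normal_diwordsP g : normal_diwords lt S g <-> exists d, normal d g.
Proof.
split=> [[a [s [b [l [Ss lP ->]]]]]|
         [_ [a b m s d Ss abm hm /lead_lpos[E1 E2]]]].
  have sb := lpos_bounds Ss; have [d sd _] := dmonicP lt_mo (S_monic Ss).
  have [m [abm hm ->]] := (posP_cpos _ _ _ sb).1 lP.
  by exists (dframe a b m d); rewrite nsd_frame //; apply: Normal.
have sb := lpos_bounds Ss.
exists a, s, b, (cpos a m (lword lt s) (lpos lt s)); rewrite nsd_frame //.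
by split=> //; apply/posP_cpos => //; exists m.
Qed.

(** Triviality bounds the terms by the leading diword of [h], which satisfies [Q] as it lies in the
    support; [Q] is closed downwards. *)
Lemma trivial_nspan Q h : (forall d e, dle lt d e -> Q e -> Q d) ->
  suppb Q h -> trivial_mod lt S h -> nspan Q h.
Proof.
move=> Qle hQ [r rN Eh]; rewrite /nspan Eh; apply: lspan_sum => p pr.
apply: lspanZ; have [/normal_diwordsP[d nd] hd] := rN p pr.
apply: (normal_nspan _ nd); have [Ed _] := normal_lead nd.
(* If [h = 0], the bound leaves no possible term [p]. *)
move: hd; rewrite Ed; case E: (lead lt h) => [e|//] /Qle; apply.
by apply: hQ; have /(leadP lt_mo)[] := E.
Qed.

(** An outer center on the middle factor keeps the type of the inner center, so a normal S-diword
    stays normal. *)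
Lemma nspan_frame_InM Q Q' A B f : (forall d, Q d -> Q' (dframe A B InM d)) ->
  nspan Q f -> nspan Q' (frame A B InM f).
Proof.
move=> QQ'; apply: lspan_linear => g [e /QQ' + ng].
case: ng => a b m s d Ss abm hm sd Qd.
apply: (normal_nspan Qd).
rewrite dframe_dframe // [X in normal _ X]frame_frame //.
apply: Normal => //; first exact: placeable_comp.
by case: hm => [->|]; [left|right].
Qed.

Lemma suppb_drop D f : suppb (fun e => dle lt e D) f -> dcoef f D = 0 ->
  suppb (fun e => dlt lt e D) f.
Proof.
move=> hf fD e fe; have /predU1P[E|//] := hf e fe.
by rewrite E fD eqxx in fe.
Qed.

Lemma suppb_sub D f g : lead lt g = Some D -> dcoef g D = 1 ->
  suppb (fun e => dle lt e D) f ->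
  suppb (fun e => dlt lt e D) (f - dcoef f D *: g).
Proof.
move=> gD g1 hf; have [_ hg] := (leadP lt_mo g D).1 gD; apply: suppb_drop.
  by apply: suppbB hf _; apply: suppbZ.
by rewrite dcoefD -scaleNr dcoefZ g1 mulr1 addrN.
Qed.

Lemma lead_diU d :
  lead lt (diU d : Di k X) = Some d /\ dcoef (diU d : Di k X) d = 1.
Proof. by apply: (lead_unitri lt_mo); rewrite subrr; apply: suppb0. Qed.

(** * Normal S-diwords and compositions lie in the ideal *)

Lemma Id_lin (c : k) f g : Id S f -> Id S g -> Id S (c *: f + g).
Proof. by have [_ h _] := Id_ideal S; apply: h. Qed.

Lemma Id0 : Id S 0.
Proof. by have [] := Id_ideal S. Qed.

Lemma IdB f g : Id S f -> Id S g -> Id S (f - g).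
Proof. by move=> If Ig; rewrite addrC -scaleN1r; apply: Id_lin. Qed.

Lemma Id_scale (c : k) f : Id S f -> Id S (c *: f).
Proof. by move=> If; have := Id_lin c If Id0; rewrite addr0. Qed.

Lemma Id_mul f g : Id S f ->
  [/\ Id S (f ⊢ g), Id S (f ⊣ g), Id S (g ⊢ f) & Id S (g ⊣ f)].
Proof. by have [_ _ h] := Id_ideal S; apply: h. Qed.

Lemma Id_gen s : S s -> Id S s.
Proof. by move=> Ss I _; apply. Qed.

Lemma Id_nsd a s b l : S s -> Id S (nsd lt a s b l).
Proof.
move=> /Id_gen Is.
have IL n f : Id S f -> Id S (dashvl a n f) /\ Id S (vdashl a n f).
  move=> If; have [_ _ h1 h2] := Id_mul (diw a n) If.
  rewrite /dashvl /vdashl; case: (a == [::]); first by split; exact: If.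
  by split; [exact: h2|exact: h1].
have IR n f : Id S f -> Id S (dashvr f b n) /\ Id S (vdashr f b n).
  move=> If; have [h1 h2 _ _] := Id_mul (diw b n) If.
  rewrite /dashvr /vdashr; case: (b == [::]); first by split; exact: If.
  by split; [exact: h2|exact: h1].
have [h1 h2] := IL l s Is; have [_ h3] := IL (size a) s Is.
rewrite /nsd; case: ifP => _; first exact: (IR 1%N _ h1).1.
case: ifP => _; first exact: (IR 1%N _ h3).1.
exact: (IR (l - size (a ++ lword lt s))%N _ h3).2.
Qed.

Lemma Id_normal d g : normal d g -> Id S g.
Proof.
by move=> ng; have [|a [s [b [l [Ss _ ->]]]]] := (normal_diwordsP g).2;
  [exists d | apply: Id_nsd].
Qed.

Lemma Id_composition h : composition lt S h -> Id S h.
Proof.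
have Idnn f g a b a' b' m n : S f -> S g ->
    Id S (nsd lt a f b m - nsd lt a' g b' n).
  by move=> Sf Sg; exact: (IdB (Id_nsd _ _ _ Sf) (Id_nsd _ _ _ Sg)).
case=> [s x Ss _|s u Ss _ _|f g a b Sf Sg _ _|*|*|*|*|*];
  try by apply: Idnn.
- by have [_ _ _ h4] := Id_mul (diw [:: x] 1) (Id_gen Ss); exact: h4.
- by have [h1 _ _ _] := Id_mul (diw u (size u)) (Id_gen Ss); exact: h1.
exact: (IdB (Id_gen Sf) (Id_nsd _ _ _ Sg)).
Qed.

(** * Statement (ii), reduction modulo [S], and bases of the quotient *)

Definition lead_closed : Prop := forall f, Id S f -> f != 0 ->
  exists2 h, normal_diwords lt S h & lead lt f = lead lt h.

Lemma normal_of_lead h D : normal_diwords lt S h -> lead lt h = Some D ->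
  normal D h.
Proof.
by move=> /normal_diwordsP[d nd]; have [-> _] := normal_lead nd => -[<-].
Qed.

(** The leading term is cancelled by a normal S-diword; this one lies in the ideal, so the remainder
    does too, with a smaller bound. *)
Lemma Id_reduce D f : lead_closed -> suppb (fun e => dle lt e D) f -> Id S f ->
  nspan (fun e => dle lt e D) f.
Proof.
move=> hS; elim/(well_founded_ind (dlt_wf lt_mo)): D f => D IH f hf If.
have low g : suppb (fun e => dlt lt e D) g -> Id S g ->
    nspan (fun e => dle lt e D) g.
  move=> /(suppb_dltP lt_mo)[-> _|[e eD he] Ig]; first exact: lspan0.
  apply: nspan_mono (IH e eD g he Ig) => d de.
  exact/dltW/(dle_dlt_trans lt_mo de).
have [fD|fD] := eqVneq (dcoef f D) 0.
  by apply: (low f) => //; apply: suppb_drop.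
have lf : lead lt f = Some D by apply/leadP.
have [h nh] := hS f If (lead_neq0 lt_mo lf); rewrite lf => /esym hD.
have {}nh := normal_of_lead nh hD; have [_ h1] := normal_lead nh.
rewrite -[f](subrK (dcoef f D *: h)); apply: lspanD.
  apply: low; first exact: suppb_sub.
  exact: IdB If (Id_scale _ (Id_normal nh)).
apply: lspanZ; apply: normal_nspan nh; exact: dle_refl.
Qed.

Lemma lead_closed_GS : lead_closed -> GS_basis lt S.
Proof.
move=> hS h /Id_composition Ih.
have [->|h0] := eqVneq h 0; first by exists [::]; rewrite ?big_nil.
have [D hD] := lead_ex lt_mo h0; have [_ hs] := (leadP lt_mo h D).1 hD.
have [r rN E] := (lspan_seq _ _).1 (Id_reduce hS hs Ih).
exists r => // p /rN[d dD nd]; split; first by apply/normal_diwordsP; exists d.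
by have [-> _] := normal_lead nd; rewrite hD.
Qed.

(** Division with remainder: the term at [D] is set aside if [D] is irreducible and cancelled by a
    normal S-diword otherwise. Both implications between (ii) and (iii) rely on it. *)
Lemma Irr_reduce D f : suppb (fun e => dle lt e D) f ->
  exists2 g, suppb (fun e => Irr lt S e /\ dle lt e D) g & Id S (f - g).
Proof.
elim/(well_founded_ind (dlt_wf lt_mo)): D f => D IH f hf.
have low f' : suppb (fun e => dlt lt e D) f' ->
    exists2 g, suppb (fun e => Irr lt S e /\ dle lt e D) g & Id S (f' - g).
  move=> /(suppb_dltP lt_mo)[->|[e eD /(IH e eD)[g hg Ig]]].
    by exists 0; [apply: suppb0|rewrite subrr; apply: Id0].
  exists g => //; apply: suppb_mono hg => d [Sd de]; split=> //.
  exact/dltW/(dle_dlt_trans lt_mo de).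
have [D_irr|] := pselect (Irr lt S D).
  have [lD D1] := lead_diU D.
  have [g hg Ig] := low _ (suppb_sub lD D1 hf).
  exists (dcoef f D *: diU D + g); last by rewrite opprD addrA.
  by apply: suppb_lin hg; apply: suppbU; split=> //; apply: dle_refl.
move=> /existsNP[h /not_implyP[nh /contrapT/esym lh]].
have {}nh := normal_of_lead nh lh; have [_ h1] := normal_lead nh.
have [g hg Ig] := low _ (suppb_sub lh h1 hf); exists g => //.
have := Id_lin (dcoef f D) (Id_normal nh) Ig.
by rewrite addrCA addrA subrK.
Qed.

(** Uniqueness of normal forms: otherwise the leading diword of [f] would be irreducible and yet
    lead a normal S-diword. *)
Lemma Irr_Id0 f : lead_closed -> suppb (Irr lt S) f -> Id S f -> f = 0.
Proof.
move=> hS fI If; have [//|f0] := eqVneq f 0.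
have [h nh] := hS f If f0; have [D fD] := lead_ex lt_mo f0.
by rewrite fD => /(fI D _ h nh); case; have [] := (leadP lt_mo f D).1 fD.
Qed.

Let img d : dquot S := dpi S (diU d).

(** In [lin_basis] the coefficients are indexed by classes. Injectivity on the support ensures that
    the coefficient gathered at a class comes from a single diword. *)
Lemma dpi_expand g :
  (forall d e, dcoef g d != 0 -> dcoef g e != 0 -> img d = img e -> d = e) ->
  exists c : dquot S -> k, (forall d, d \in dsupp g -> c (img d) = dcoef g d) /\
    dpi S g = \sum_(v <- map img (dsupp g)) c v *: v.
Proof.
move=> inj; exists (fun v => \sum_(d <- dsupp g | img d == v) dcoef g d).
have Ec d : d \in dsupp g ->
    \sum_(e <- dsupp g | img e == img d) dcoef g e = dcoef g d.
  move=> dg; rewrite big_mkcond (bigD1_seq d) ?fset_uniq //= eqxx.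
  rewrite big1 ?addr0 // => e ed; case: eqP => // E.
  apply/eqP; apply: contraNT ed => ge; apply/eqP.
  by apply: inj E => //; rewrite -mem_dsupp.
split; first exact: Ec.
rewrite big_map {1}[g]DiE dpi_sum; apply: eq_big_seq => d dg.
exact: (congr1 (fun x => x *: img d) (esym (Ec d dg))).
Qed.

Lemma lead_closed_basis : lead_closed -> Irr_basis lt S.
Proof.
move=> hS.
have inj d e : Irr lt S d -> Irr lt S e -> img d = img e -> d = e.
  move=> dI eI /dpiP/(Irr_Id0 hS) E.
  have {}E : diU d - diU e = 0 :> Di k X.
    by apply: E; apply: suppbB; apply: suppbU.
  apply/eqP; apply: contraT => ne; have := congr1 (fun f => dcoef f d) E.
  rewrite dcoefD -scaleN1r dcoefZ !dcoefU dcoef0 eqxx eq_sym (negPf ne).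
  by rewrite mulr0 addr0 => /eqP; rewrite oner_eq0.
split; first exact: inj.
split=> [r c r_uniq rI E v vr|w].
  (* The classes are lifted to distinct irreducible diwords. The lifted relation lies in the ideal
     and has irreducible support, hence vanishes. *)
  have [ds dsI Er] :
      exists2 ds, forall d, d \in ds -> Irr lt S d & r = map img ds.
    elim: r rI {r_uniq E vr} => [|u r IH] rI; first by exists [::].
    have [|ds dsI ->] := IH.
      by move=> x xr; apply: rI; rewrite in_cons xr orbT.
    have [d dI <-] := rI u (mem_head _ _); exists (d :: ds) => //.
    by move=> e /predU1P[->|/dsI].
  have ds_uniq : uniq ds by apply: (@map_uniq _ _ img); rewrite -Er.
  pose f := \sum_(d <- ds) c (img d) *: (diU d : Di k X).
  have f0 : f = 0.
    apply: (Irr_Id0 hS).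
      by apply: suppb_sum => d /dsI dI; apply: suppbZ; apply: suppbU.
    by apply/dpi_eq0; rewrite /f dpi_sum -[RHS]E Er big_map.
  move: vr; rewrite Er => /mapP[d dds ->].
  have := congr1 (fun f => dcoef f d) f0; rewrite dcoef0 /f dcoef_sum.
  rewrite (bigD1_seq d) //= big1 ?addr0; last first.
    by move=> e /negPf ed; rewrite dcoefZ dcoefU ed mulr0.
  by rewrite dcoefZ dcoefU eqxx mulr1.
rewrite -[w]dreprK; set f := drepr w.
have [g gI Ig] : exists2 g, suppb (Irr lt S) g & Id S (f - g).
  have [->|/(lead_ex lt_mo)[D /(leadP lt_mo)[_ hD]]] := eqVneq f 0.
    by exists 0; [apply: suppb0|rewrite subrr; apply: Id0].
  have [g hg Ig] := Irr_reduce hD; exists g => //.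
  by apply: suppb_mono hg => d [].
have [c [_ Eg]] := @dpi_expand g (fun d e gd ge => inj d e (gI d gd) (gI e ge)).
exists (map img (dsupp g)), c; split; last by rewrite -Eg; apply/dpiP.
by move=> v /mapP[d dg ->]; exists d => //; apply: gI; rewrite -mem_dsupp.
Qed.

(** If the leading diword [D] of [f] led no normal S-diword, reducing the lower terms of [f] would
    give an element of the ideal with irreducible support and nonzero coefficient at [D], a
    forbidden relation in the quotient. *)
Lemma basis_lead_closed : Irr_basis lt S -> lead_closed.
Proof.
move=> [inj [indep _]] f If f0; have [D fD] := lead_ex lt_mo f0.
have [fD0 hf] := (leadP lt_mo f D).1 fD.
apply: contrapT => nf; have D_irr : Irr lt S D.
  by move=> h nh E; apply: nf; exists h => //; rewrite fD.
have [lD D1] := lead_diU D.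
have [y yI [Iy yD]] : exists2 y, suppb (Irr lt S) y & Id S y /\ dcoef y D != 0.
  (* Either [f] is just its leading term, or the normal form of the rest is bounded by some [e]
     below [D] and cannot touch the coefficient at [D]. *)
  have [E|[e eD he]] := suppb_dltP lt_mo (suppb_sub lD D1 hf).
    exists (dcoef f D *: diU D); first by apply: suppbZ; apply: suppbU.
    rewrite -[_ *: _](subrK f) -opprB E oppr0 add0r; split=> //.
  have [g hg Ig] := Irr_reduce he; exists (dcoef f D *: diU D + g).
    by apply: suppb_lin; [apply: suppbU|apply: suppb_mono hg => d []].
  split.
    by rewrite (subr_subr f); apply: IdB.
  rewrite dcoefD dcoefZ D1 mulr1; set r := dcoef g D.
  suff -> : r = 0 by rewrite addr0.
  apply/eqP; apply: contraFT (dlt_irr lt_mo D) => /hg[_ De].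
  exact: (dle_dlt_trans lt_mo De eD).
have injy d e : dcoef y d != 0 -> dcoef y e != 0 -> img d = img e -> d = e.
  by move=> /yI dI /yI eI; apply: inj.
have [c [Ec Ey]] := dpi_expand injy.
rewrite (dpi_eq0 S y).2 // in Ey.
have D_supp : D \in dsupp y by rewrite mem_dsupp.
have := indep (map img (dsupp y)) c _ _ (esym Ey) (img D).
rewrite Ec // => h; move: yD; rewrite h ?eqxx //.
- rewrite map_inj_in_uniq ?fset_uniq // => d e; rewrite !mem_dsupp; exact: injy.
- move=> v /mapP[d]; rewrite mem_dsupp => /yI dI ->; by exists d.
by apply/mapP; exists D.
Qed.

(** * Products of normal S-diwords by diwords, when compositions are trivial *)

Context (GS : GS_basis lt S).

(** For [s] not strong, the composition of right multiplication applies to the prefix of [b] of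
    length [n], whose last letter is the center. The rest of [b] is then multiplied with the center
    on the middle factor. *)
Lemma frame_InR a b n s d : S s -> lead lt s = Some d ->
  (1 <= n <= size b)%N ->
  nspan (fun e => dle lt e (dframe a b (InR n) d)) (frame a b (InR n) s).
Proof.
move=> Ss sd bn; have [hs|ns] := boolP (strong lt s).
  apply: frame_nspan => //; by right.
have un : size (take n b) = n by rewrite size_takel //; lia.
have pu : placeable [::] (take n b) (InR n) by rewrite /= un; lia.
pose D := dframe [::] (take n b) (InR n) d.
have : nspan (fun e => dle lt e D) (frame [::] (take n b) (InR n) s).
  apply: trivial_nspan => [e i ei|| ]; first exact: (dle_trans lt_mo ei).
    have [_ h] := (leadP lt_mo s d).1 sd.
    by apply: suppb_frame h => // e; apply: dle_dframe.
  apply: GS; rewrite -(vdash_diw_frame _ pu) -[X in diw _ X]un.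
  apply: Comp_right => //.
  by rewrite inE -size_eq0 un; lia.
have -> : frame a b (InR n) s =
    frame a (drop n b) InM (frame [::] (take n b) (InR n) s).
  by rewrite (frame_frame _ _ _ _ pu) /= cats0 cat_take_drop.
have -> : dframe a b (InR n) d = dframe a (drop n b) InM D.
  rewrite (dframe_dframe _ (isT : placeable _ _ InM) pu) /=.
  by rewrite cats0 cat_take_drop.
by apply: nspan_frame_InM => e; apply: dle_dframe.
Qed.

(* Composition of left multiplication, applied to the last letter x of a,
   replaces x s by normal S-diwords.  The remaining product by a = a' x needs the
   same treatment only if its word drops, or if the word is kept and the element
   of S starts exactly at x, so that the left factor a' is shorter than a. *)
Lemma frame_InL a b n s d : S s -> lead lt s = Some d ->
  (1 <= n <= size a)%N ->
  nspan (fun e => dle lt e (dframe a b (InL n) d)) (frame a b (InL n) s).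
Proof.
move: {2}(a ++ dword d ++ b) (erefl (a ++ dword d ++ b)) => w.
elim/(well_founded_ind (mo_wf lt_mo)): w a b n s d => w IHw a.
move: {2}(size a) (erefl (size a)) => N.
elim/ltn_ind: N a => N IHN a aN b n s d Ew Ss sd an.
have [hs|ns] := boolP (strong lt s).
  apply: frame_nspan => //; by right.
case/lastP: a an aN Ew => [/=|a x an aN Ew]; first lia.
rewrite size_rcons in an aN.
pose D := dframe [:: x] [::] (InL 1) d.
have hD : nspan (fun e => dle lt e D) (frame [:: x] [::] (InL 1) s).
  apply: trivial_nspan => [e i ei|| ]; first exact: (dle_trans lt_mo ei).
    have [_ h] := (leadP lt_mo s d).1 sd.
    by apply: suppb_frame h => // e; apply: dle_dframe.
  by apply: GS; rewrite -diw_dashv_frame //; apply: Comp_left.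
(* If the center is the letter [x] itself, the remaining product by [a] has its center on the middle
   factor and needs no induction. *)
pose M := if n == (size a).+1 then InM else InL n.
have pM : placeable a b M by rewrite /M; case: eqP => //= *; lia.
have px : placeable [:: x] [::] (InL 1) by [].
have EM : comp_center (size a) 0 M (InL 1) = InL n.
  by rewrite /M; case: eqP => //= ->; rewrite addn1.
have Ef : frame (rcons a x) b (InL n) s =
    frame a b M (frame [:: x] [::] (InL 1) s).
  by rewrite (frame_frame _ _ _ _ px) EM cats1.
have Ed : dframe (rcons a x) b (InL n) d = dframe a b M D.
  by rewrite (dframe_dframe _ pM px) EM cats1.
rewrite {}Ef {}Ed; move: pM; rewrite /M; case: eqP => na pM {M EM}.
  by apply: nspan_frame_InM hD => e; apply: dle_dframe.
have {}na : (1 <= n <= size a)%N by lia.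
apply: lspan_linear hD => g [e ed ng].
have hle := dle_dframe lt_mo (na : placeable a b (InL n)) ed.
apply: nspan_mono (fun i ie => dle_trans lt_mo ie hle) _.
case: ng ed {hle} => a' b' m s' d' Ss' pm hm sd' ed.
rewrite dframe_dframe // [X in nspan _ X]frame_frame //=.
have [hs'|ns'] := boolP (strong lt s').
  apply: frame_nspan => //=; last by right.
  by rewrite size_cat; lia.
have {}hm : m = InM by case: hm => // h; rewrite h in ns'.
move: ed; rewrite dleE // /D !dword_dframe // !dpos_dframe // hm /= cats0.
case/orP=> [l|/andP[/eqP E dp]].
  apply: (IHw ((a ++ a') ++ dword d' ++ (b' ++ b))) => //; last first.
    by rewrite size_cat; lia.
  rewrite -Ew -cats1 -!catA (catA a a'); apply/and3P; split.
  - exact: cat_diword_neq0.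
  - by rewrite catA; apply: cat_diword_neq0.
  rewrite -catA.
  have := @mo_cat _ _ lt_mo a b (a' ++ dword d' ++ b') (x :: dword d).
  by rewrite -!catA; apply=> //; apply: cat_diword_neq0.
(* [D] has center 1, so [dp] bounds the length of [a'] plus a position at least 1 by 1. *)
have a'0 : a' = [::].
  by apply/nilP; have := diword_bounds d'; rewrite /nilp; lia.
subst a'; rewrite cats0.
apply: (IHN (size a)) => //; first lia.
rewrite -Ew -cats1 -!catA /=; congr cat.
by rewrite catA -[dword d' ++ b']/([::] ++ dword d' ++ b') E.
Qed.

(** After the two frames are merged, an outer center on the middle factor keeps normality, and the
    other two are [frame_InL] and [frame_InR]. *)
Lemma frame_normal A B M d g : placeable A B M -> normal d g ->
  nspan (fun e => dle lt e (dframe A B M d)) (frame A B M g).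
Proof.
move=> hM; case=> a b m s {}d Ss abm hm sd.
have := placeable_comp hM abm; rewrite dframe_dframe // frame_frame //.
case: M hM => [n||n] hM /= pm.
- exact: frame_InL.
- apply: frame_nspan => //.
  by case: hm => [->|]; [left|right].
exact: frame_InR.
Qed.

(** * Differences of normal S-diwords with the same leading diword *)

(* With s1 = d1 + r1 and s2 = d2 + r2, where d1, d2 are the leading terms, the
   difference is <r1, s2> - <s1, r2> for a bilinear product <f, g> = (a f c g b);
   K1 e and K2 d describe its center relative to f and to g. *)
Lemma bilinear_difference a b c (K1 K2 : diword X -> center) s1 s2 d1 d2 :
  S s1 -> S s2 -> lead lt s1 = Some d1 -> lead lt s2 = Some d2 ->
  (forall e, placeable a (c ++ dword e ++ b) (K1 e) /\ center_ok (K1 e) s1) ->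
  (forall d, placeable (a ++ dword d ++ c) b (K2 d) /\ center_ok (K2 d) s2) ->
  (forall d e, cpos a (K1 e) (dword d) (dpos d) =
     cpos (a ++ dword d ++ c) (K2 d) (dword e) (dpos e)) ->
  nspan (fun e => dlt lt e (dframe a (c ++ dword d2 ++ b) (K1 d2) d1))
    (frame a (c ++ dword d2 ++ b) (K1 d2) s1 -
     frame (a ++ dword d1 ++ c) b (K2 d1) s2).
Proof.
move=> Ss1 Ss2 sd1 sd2 hK1 hK2 EK.
(* Two expansions of the same product: [T1] over the diwords of [g], [T2] over those of [f]. *)
pose T1 f g := lmap (fun e => frame a (c ++ dword e ++ b) (K1 e) f) g.
pose T2 f g := lmap (fun d => frame (a ++ dword d ++ c) b (K2 d) g) f.
have T12 f g : T1 f g = T2 f g.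
  transitivity (\sum_(e <- dsupp g) \sum_(d <- dsupp f) dcoef g e *:
      (dcoef f d *: (diw (a ++ dword d ++ c ++ dword e ++ b)
         (cpos a (K1 e) (dword d) (dpos d)) : Di k X))).
    by apply: eq_bigr => e _; exact: scaler_sumr.
  rewrite exchange_big; apply: eq_bigr => d _ /=.
  rewrite scaler_sumr; apply: eq_bigr => e _.
  by rewrite !scalerA mulrC EK -!catA.
have Ed d e : dframe a (c ++ dword e ++ b) (K1 e) d =
    dframe (a ++ dword d ++ c) b (K2 d) e.
  have [p1 _] := hK1 e; have [p2 _] := hK2 d.
  by apply: diword_inj; rewrite ?dword_dframe ?dpos_dframe // -?catA.
have -> : frame a (c ++ dword d2 ++ b) (K1 d2) s1 = T1 s1 (diU d2).
  by rewrite /T1 lmapU.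
have -> : frame (a ++ dword d1 ++ c) b (K2 d1) s2 = T2 (diU d1) s2.
  by rewrite /T2 lmapU.
have -> : T1 s1 (diU d2) - T2 (diU d1) s2 =
    T2 (s1 - diU d1) s2 - T1 s1 (s2 - diU d2).
  have linT (F : diword X -> Di k X) f g : lmap F (f - g) = lmap F f - lmap F g.
    by apply: linB; apply: lmap_is_linear.
  have -> : T1 s1 (s2 - diU d2) = T1 s1 s2 - T1 s1 (diU d2) by apply: linT.
  have -> : T2 (s1 - diU d1) s2 = T2 s1 s2 - T2 (diU d1) s2 by apply: linT.
  by rewrite -(T12 s1 s2) opprB [RHS]addrC addrA subrK.
(* In the first sum a diword [e] of the rest of [s1] is frozen, which leaves a normal S-diword of
   [s2]; [Ed] rereads its leading diword as a frame around [e], which is below [d1]. The second sum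
   is symmetric. *)
apply: lspanB; rewrite /T1 /T2 /lmap; apply: lspan_sum => e.
  rewrite mem_dsupp => he; apply: lspanZ.
  have [p1 _] := hK1 d2; have [p2 ok2] := hK2 e.
  apply: (normal_nspan (d := dframe (a ++ dword e ++ c) b (K2 e) d2)).
    rewrite -Ed; have [h1 h2] := leading_rest Ss1 sd1.
    have [_ ok1] := hK1 d2.
    apply: dlt_dframe => //; last exact: h1.
    by case: ok1 => [|/h2 h]; [left|right; apply: h].
  exact: Normal.
rewrite mem_dsupp => he; apply: lspanZ.
have [p1 ok1] := hK1 e; have [p2 ok2] := hK2 d1.
apply: (normal_nspan (d := dframe a (c ++ dword e ++ b) (K1 e) d1)).
  rewrite !Ed; have [h1 h2] := leading_rest Ss2 sd2.
  apply: dlt_dframe => //; last exact: h1.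
  by case: ok2 => [|/h2 h]; [left|right; apply: h].
exact: Normal.
Qed.

(** The given centers fix a place in the word: inside [a], the first factor, [c], the second factor,
    or [b]. [K1] and [K2] follow that place as the factors vary. *)
Lemma disjoint_difference a b c m1 m2 s1 s2 d1 d2 :
  S s1 -> S s2 -> lead lt s1 = Some d1 -> lead lt s2 = Some d2 ->
  placeable a (c ++ dword d2 ++ b) m1 -> placeable (a ++ dword d1 ++ c) b m2 ->
  center_ok m1 s1 -> center_ok m2 s2 ->
  cpos a m1 (dword d1) (dpos d1) =
    cpos (a ++ dword d1 ++ c) m2 (dword d2) (dpos d2) ->
  nspan (fun e => dlt lt e (dframe a (c ++ dword d2 ++ b) m1 d1))
    (frame a (c ++ dword d2 ++ b) m1 s1 - frame (a ++ dword d1 ++ c) b m2 s2).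
Proof.
move=> Ss1 Ss2 sd1 sd2 p1 p2 ok1 ok2 E.
have b1 := diword_bounds d1; have b2 := diword_bounds d2.
suff [K1 [K2 [E1 E2 hK1 hK2 hE]]] : exists K1 K2 : diword X -> center,
    [/\ K1 d2 = m1, K2 d1 = m2,
     forall e, placeable a (c ++ dword e ++ b) (K1 e) /\ center_ok (K1 e) s1,
     forall d, placeable (a ++ dword d ++ c) b (K2 d) /\ center_ok (K2 d) s2
     & forall d e, cpos a (K1 e) (dword d) (dpos d) =
         cpos (a ++ dword d ++ c) (K2 d) (dword e) (dpos e)].
  by rewrite -E1 -E2; apply: bilinear_difference.
(* A center off the factor forces strength, which in turn allows every center. *)
have ok m n s (Em : m <> InM) : center_ok m s -> center_ok n s.
  by case=> // h; right.
(* Four of the nine pairs contradict [E]; the other five are the five places. *)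
case: m1 m2 => [n1||n1] [n2||n2] in p1 p2 ok1 ok2 E *;
  rewrite /= ?size_cat in p1 p2 E.
- exists (fun _ => InL n1), (fun _ => InL n1); split=> //= [|d].
  + by rewrite E.
  by split; [rewrite !size_cat; lia|apply: ok ok2].
- lia.
- lia.
- exists (fun _ => InM), (fun d => InL (size a + dpos d)); split=> //=.
  + by rewrite E.
  move=> d; split; last exact: ok ok2.
  by rewrite !size_cat; have := diword_bounds d; lia.
- lia.
- lia.
- exists (fun _ => InR n1), (fun d => InL (size a + size (dword d) + n1)).
  split=> //=.
  + by rewrite E.
  + by move=> e; split=> //; rewrite !size_cat; lia.
  move=> d; split; last exact: ok ok2.
  by rewrite !size_cat; lia.
- exists (fun e => InR (size c + dpos e)), (fun d => InM); split=> //=.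
  + by congr InR; lia.
  + move=> e; split; last exact: ok ok1.
    by rewrite !size_cat; have := diword_bounds e; lia.
  by move=> d e; rewrite !size_cat; lia.
exists (fun e => InR (size c + size (dword e) + n2)), (fun d => InR n2).
split=> //=.
- by congr InR; lia.
- move=> e; split; last exact: ok ok1.
  by rewrite !size_cat; lia.
by move=> d e; rewrite !size_cat; lia.
Qed.

(** An outer center on the overlap word preserves strict bounds between diwords. Otherwise both
    elements are strong, the difference is bounded by smaller words, and [frame_normal] copes with
    any outer center. *)
Lemma frame_difference (A B c1 e1 c2 e2 : seq X) M m1 m2 f g df dg :
  S f -> S g -> lead lt f = Some df -> lead lt g = Some dg ->
  placeable A B M -> placeable c1 e1 m1 -> placeable c2 e2 m2 ->
  dframe c1 e1 m1 df = dframe c2 e2 m2 dg ->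
  [/\ M = InM, center_ok m1 f & center_ok m2 g] \/ strong lt f /\ strong lt g ->
  trivial_mod lt S (frame c1 e1 m1 f - frame c2 e2 m2 g) ->
  nspan (fun e => dlt lt e (dframe A B M (dframe c1 e1 m1 df)))
    (frame A B M (frame c1 e1 m1 f - frame c2 e2 m2 g)).
Proof.
move=> Sf Sg fd gd pM p1 p2 E hs htriv.
have Ew : c1 ++ dword df ++ e1 = c2 ++ dword dg ++ e2.
  by rewrite -(dword_dframe _ p1) E dword_dframe.
have Ediff : frame c1 e1 m1 f - frame c2 e2 m2 g =
    (frame c1 e1 m1 f - diU (dframe c1 e1 m1 df)) -
    (frame c2 e2 m2 g - diU (dframe c2 e2 m2 dg)).
  by rewrite E; apply: subr_common.
case: hs => [[EM ok1 ok2]|[sf sg]].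
  rewrite EM; apply: nspan_frame_InM.
    by move=> d; apply: dlt_dframe => //; left.
  apply: trivial_nspan htriv; first by move=> d e; apply: dle_dlt_trans.
  rewrite Ediff; apply: suppbB; first exact: frame_rest.
  by rewrite E; apply: frame_rest.
have : nspan (fun e => lt (dword e) (c1 ++ dword df ++ e1))
    (frame c1 e1 m1 f - frame c2 e2 m2 g).
  apply: trivial_nspan htriv.
    move=> d e; rewrite dleE // -(dword_dframe _ p1).
    by case/orP=> [|/andP[/eqP->]//]; apply: dlt_word_trans.
  rewrite Ediff; apply: suppbB; first exact: frame_rest_word.
  by rewrite Ew; apply: frame_rest_word.
apply: lspan_linear => g' [d' hd' /(frame_normal pM)].
apply: nspan_mono => e he; apply: dle_dlt_trans he _ => //.
by apply: dlt_dframe_word => //; rewrite dword_dframe.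
Qed.

(* Covers inclusions and intersections at once.  If the center of D lies in the
   overlap word, the composition with that center applies.  Otherwise f and g are
   strong, and any composition with the same overlap does, since the outer product
   forgets its center; if there is none, one letter is taken from A or B to form
   a multiplicative composition. *)
Lemma critical_difference (A B c1 e1 c2 e2 : seq X) M1 M2 f g df dg :
  S f -> S g -> lead lt f = Some df -> lead lt g = Some dg ->
  c1 ++ dword df ++ e1 = c2 ++ dword dg ++ e2 ->
  let common m1 m2 := [/\ placeable c1 e1 m1, center_ok m1 f,
      placeable c2 e2 m2, center_ok m2 g
    & dframe c1 e1 m1 df = dframe c2 e2 m2 dg] in
  (forall m1 m2, common m1 m2 ->
     trivial_mod lt S (frame c1 e1 m1 f - frame c2 e2 m2 g)) ->
  (~ (exists m1 m2, common m1 m2) -> strong lt f -> strong lt g ->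
   forall x, trivial_mod lt S
       (frame (x :: c1) e1 (InL 1) f - frame (x :: c2) e2 (InL 1) g) /\
     trivial_mod lt S
       (frame c1 (e1 ++ [:: x]) (InR (size e1).+1) f -
        frame c2 (e2 ++ [:: x]) (InR (size e2).+1) g)) ->
  placeable (A ++ c1) (e1 ++ B) M1 -> center_ok M1 f ->
  placeable (A ++ c2) (e2 ++ B) M2 -> center_ok M2 g ->
  dframe (A ++ c1) (e1 ++ B) M1 df = dframe (A ++ c2) (e2 ++ B) M2 dg ->
  nspan (fun e => dlt lt e (dframe (A ++ c1) (e1 ++ B) M1 df))
    (frame (A ++ c1) (e1 ++ B) M1 f - frame (A ++ c2) (e2 ++ B) M2 g).
Proof.
move=> Sf Sg fd gd Ew common hc hx p1 ok1 p2 ok2 ED.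
have Epos := congr1 (@dpos X) ED; rewrite !dpos_dframe // in Epos.
have Esize := congr1 size Ew; rewrite !size_cat in Esize.
have bf := diword_bounds df; have bg := diword_bounds dg.
(* A splitting into a common outer frame [A'], [B'] with center [M] and two inner frames whose
   difference is trivial; what remains is to find one in each case. *)
pose factored M m1 m2 a1 b1 a2 b2 A' B' :=
  [/\ placeable A' B' M, placeable a1 b1 m1, placeable a2 b2 m2,
      a1 ++ dword df ++ b1 = a2 ++ dword dg ++ b2 &
   [/\ cpos a1 m1 (dword df) (dpos df) = cpos a2 m2 (dword dg) (dpos dg),
      [/\ M = InM, center_ok m1 f & center_ok m2 g] \/
        strong lt f /\ strong lt g,
      trivial_mod lt S (frame a1 b1 m1 f - frame a2 b2 m2 g),
      [/\ A ++ c1 = A' ++ a1, A ++ c2 = A' ++ a2,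
          e1 ++ B = b1 ++ B' & e2 ++ B = b2 ++ B']
    & comp_center (size A') (size b1) M m1 = M1 /\
      comp_center (size A') (size b2) M m2 = M2]].
suff [M [m1 [m2 [a1 [b1 [a2 [b2 [A' [B']]]]]]]]] :
    exists M m1 m2 a1 b1 a2 b2 A' B', factored M m1 m2 a1 b1 a2 b2 A' B'.
  case=> pM q1 q2 Ew' [Ep hs ht [-> -> -> ->] [<- <-]].
  rewrite -(frame_frame _ _ _ _ q1) -(frame_frame _ _ _ _ q2) -linearB /=.
  rewrite -dframe_dframe //; apply: (frame_difference (dg := dg)) => //.
  by apply: diword_inj; rewrite ?dword_dframe ?dpos_dframe.
have okn m n s (Em : m <> InM) : center_ok m s -> center_ok n s.
  by case=> // h; right.
have strn m s (Em : m <> InM) : center_ok m s -> strong lt s by case.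
have commonE m1 m2 : common m1 m2 ->
    cpos c1 m1 (dword df) (dpos df) = cpos c2 m2 (dword dg) (dpos dg).
  by case=> q1 _ q2 _ /(congr1 (@dpos X)); rewrite !dpos_dframe.
have [hl|hl] := leqP (cpos (A ++ c1) M1 (dword df) (dpos df)) (size A).
  have {p1 p2 ok1 ok2 Epos ED} [l [EM1 EM2 lA [sf sg]]] : exists l,
      [/\ M1 = InL l, M2 = InL l, (1 <= l <= size A)%N
        & strong lt f /\ strong lt g].
    clear factored.
    case: M1 M2 => [n1||n1] [n2||n2] in p1 p2 ok1 ok2 Epos hl ED *;
      rewrite /= ?size_cat in p1 p2 Epos hl; try lia.
    exists n1; rewrite Epos; split=> //; first by rewrite -Epos; lia.
    by split; [apply: strn ok1|apply: strn ok2].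
  have [[m1 [m2 h12]]|nc] := pselect (exists m1 m2, common m1 m2).
    exists (InL l), m1, m2, c1, e1, c2, e2, A, B.
    have [q1 _ q2 _ _] := h12; split=> //.
    by split=> //; [exact: commonE|right|exact: hc].
  rewrite /factored; clear factored hl.
  case/lastP: A lA => [|A x] lA; first by move: lA => /=; lia.
  rewrite size_rcons in lA.
  (* The last letter [x] of the left factor becomes the inner center; the outer center is on the
     middle factor exactly when [x] was the original center. *)
  exists (if l == (size A).+1 then InM else InL l), (InL 1), (InL 1),
    (x :: c1), e1, (x :: c2), e2, A, B; split=> //.
  - by case: eqP => //= *; lia.
  - by rewrite /= Ew.
  split=> //; [by right|by have [] := hx nc sf sg x|by rewrite !cat_rcons|].
  by rewrite EM1 EM2; case: eqP => //= ->; rewrite addn1.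
have [hr|hr] := ltnP (size A + size c1 + size (dword df) + size e1)
    (cpos (A ++ c1) M1 (dword df) (dpos df)).
  have {p1 p2 ok1 ok2 Epos ED} [l [EM1 EM2 lB [sf sg]]] : exists l,
      [/\ M1 = InR (size e1 + l), M2 = InR (size e2 + l), (1 <= l <= size B)%N
        & strong lt f /\ strong lt g].
    clear factored.
    case: M1 M2 => [n1||n1] [n2||n2] in p1 p2 ok1 ok2 Epos hr hl ED *;
      rewrite /= ?size_cat in p1 p2 Epos hr hl; try lia.
    exists (n1 - size e1)%N; split=> //; [congr InR; lia|congr InR; lia|lia|].
    by split; [apply: strn ok1|apply: strn ok2].
  have [[m1 [m2 h12]]|nc] := pselect (exists m1 m2, common m1 m2).
    exists (InR l), m1, m2, c1, e1, c2, e2, A, B.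
    have [q1 _ q2 _ _] := h12; split=> //.
    by split=> //; [exact: commonE|right|exact: hc].
  rewrite /factored; clear factored hr.
  case: B lB => [|x B] lB; first by move: lB => /=; lia.
  (* Symmetrically for the first letter [x] of the right factor; a center further right loses one
     position, hence [l.-1]. *)
  exists (if l == 1%N then InM else InR l.-1),
    (InR (size e1).+1), (InR (size e2).+1),
    c1, (e1 ++ [:: x]), c2, (e2 ++ [:: x]), A, B; rewrite /= in lB; split=> //.
  - by case: eqP => //= *; lia.
  - by rewrite /= size_cat /= addn1 leqnn.
  - by rewrite /= size_cat /= addn1 leqnn.
  - by have := congr1 (cat^~ [:: x]) Ew; rewrite -!catA.
  split=> //=; [lia|by right|by have [] := hx nc sf sg x|by rewrite -!catA|].
  by rewrite EM1 EM2 !size_cat; case: eqP => [->|l1] /=; split; congr InR; lia.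
(* The center now lies in the overlap word; centers counted from the start of [A] are recounted from
   its end. *)
pose sh m := if m is InL n then InL (n - size A) else m.
have [q1 q2 Ep] : [/\ placeable c1 e1 (sh M1), placeable c2 e2 (sh M2)
    & cpos c1 (sh M1) (dword df) (dpos df) =
      cpos c2 (sh M2) (dword dg) (dpos dg)].
  clear factored.
  case: M1 M2 => [n1||n1] [n2||n2] in p1 p2 ok1 ok2 ED Epos hr hl *;
    rewrite /= ?size_cat in p1 p2 Epos hr hl *; split=> //; lia.
have oksh m s : center_ok m s -> center_ok (sh m) s.
  by case=> [->|h]; [left|right].
have h12 : common (sh M1) (sh M2).
  split; [exact: q1|exact: oksh|exact: q2|exact: oksh|].
  by apply: diword_inj; rewrite ?dword_dframe ?dpos_dframe.
exists InM, (sh M1), (sh M2), c1, e1, c2, e2, A, B.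
split=> //; split=> //.
- by left; split=> //; apply: oksh.
- exact: hc.
clear factored h12 q1 q2 Ep.
case: M1 M2 => [n1||n1] [n2||n2] in p1 p2 ok1 ok2 ED Epos hr hl *;
  rewrite /= ?size_cat in p1 p2 Epos hr hl *; split=> //; congr InL; lia.
Qed.

Lemma common_center a b m s d : S s -> lead lt s = Some d ->
  placeable a b m -> center_ok m s ->
  cpos a m (dword d) (dpos d) \in posP lt a s b /\
  nsd lt a s b (cpos a m (dword d) (dpos d)) = frame a b m s.
Proof.
move=> Ss sd pm ok; have sb := lpos_bounds Ss.
have [<- <-] := lead_lpos sd; rewrite nsd_frame //; split=> //.
by apply/posP_cpos => //; exists m.
Qed.

Lemma nsdE a b m s d l : S s -> lead lt s = Some d ->
  placeable a b m -> center_ok m s -> l = cpos a m (dword d) (dpos d) ->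
  nsd lt a s b l = frame a b m s.
Proof. by move=> Ss sd pm ok ->; have [] := common_center Ss sd pm ok. Qed.

(** The case of [critical_difference] with nothing around [f]: the inner center of [f] can only be
    [InM], and common centers amount to $p(\overline f)\in P([agb])$. *)
Lemma inclusion_difference A B a b M1 M2 f g df dg :
  S f -> S g -> lead lt f = Some df -> lead lt g = Some dg ->
  dword df = a ++ dword dg ++ b ->
  placeable A B M1 -> center_ok M1 f ->
  placeable (A ++ a) (b ++ B) M2 -> center_ok M2 g ->
  dframe A B M1 df = dframe (A ++ a) (b ++ B) M2 dg ->
  nspan (fun e => dlt lt e (dframe A B M1 df))
    (frame A B M1 f - frame (A ++ a) (b ++ B) M2 g).
Proof.
move=> Sf Sg fd gd Ew p1 ok1 p2 ok2 ED.
have [Ef1 Ef2] := lead_lpos fd; have [Eg1 Eg2] := lead_lpos gd.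
have Ew' : lword lt f = a ++ lword lt g ++ b by rewrite Ef1 Eg1.
have H : [::] ++ dword df ++ [::] = a ++ dword dg ++ b by rewrite cats0.
have := critical_difference (A := A) (B := B) (M1 := M1) (M2 := M2)
  Sf Sg fd gd H.
rewrite [A ++ [::]]cats0.
apply; [| |exact: p1|exact: ok1|exact: p2|exact: ok2|exact: ED].
- move=> m1 m2 [q1 k1 q2 k2 E].
  have m1M : m1 = InM by case: (m1) q1 => //= n; lia.
  have Ep := congr1 (@dpos X) E; rewrite m1M !dpos_dframe //= ?add0n in Ep.
  rewrite m1M frame_nil; apply: GS.
  have [hm <-] := common_center Sg gd q2 k2.
  by rewrite -Ep -Ef2 in hm *; apply: Comp_incl.
move=> nc sf sg x.
have hn : lpos lt f \notin posP lt a g b.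
  apply/negP => /(posP_cpos _ _ _ (lpos_bounds Sg)) [m [q ok E]]; apply: nc.
  exists InM, m; split=> //; first by left.
  apply: diword_inj; first by rewrite !dword_dframe //= cats0.
  by rewrite !dpos_dframe //= ?add0n -Ef2 E Eg1 Eg2.
have okf m : center_ok m f by right.
have okg m : center_ok m g by right.
split; apply: GS.
  have := Comp_incl_left x Sf Sg Ew' hn sf sg.
  by rewrite (nsdE (m := InL 1) Sf fd) // (nsdE (m := InL 1) Sg gd).
have := Comp_incl_right x Sf Sg Ew' hn sf sg; cbv zeta.
rewrite (nsdE (m := InR 1) Sf fd) //; last by rewrite size_cat Ef1.
(* The center is the appended letter [x], which comes right after the letters of [b]. *)
rewrite (nsdE (m := InR (size b).+1) Sg gd) //.
  by rewrite /= size_cat addn1 leqnn.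
by rewrite Ew' Eg1 !size_cat /=; lia.
Qed.

(** The case of [critical_difference] with nothing to the left of [f] or to the right of [g]; common
    centers are the common elements of $P([fb])$ and $P([ag])$. *)
Lemma intersection_difference A B a b M1 M2 f g df dg :
  S f -> S g -> lead lt f = Some df -> lead lt g = Some dg ->
  dword df ++ b = a ++ dword dg ->
  (size (dword df ++ b) < size (dword df) + size (dword dg))%N ->
  placeable A (b ++ B) M1 -> center_ok M1 f ->
  placeable (A ++ a) B M2 -> center_ok M2 g ->
  dframe A (b ++ B) M1 df = dframe (A ++ a) B M2 dg ->
  nspan (fun e => dlt lt e (dframe A (b ++ B) M1 df))
    (frame A (b ++ B) M1 f - frame (A ++ a) B M2 g).
Proof.
move=> Sf Sg fd gd Ew lt_fg p1 ok1 p2 ok2 ED.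
have [Ef1 Ef2] := lead_lpos fd; have [Eg1 Eg2] := lead_lpos gd.
have Ew' : lword lt f ++ b = a ++ lword lt g by rewrite Ef1 Eg1.
have lt_fg' :
    (size (lword lt f ++ b) < size (lword lt f) + size (lword lt g))%N.
  by rewrite Ef1 Eg1.
have H : [::] ++ dword df ++ b = a ++ dword dg ++ [::] by rewrite cats0.
have := critical_difference (A := A) (B := B) (M1 := M1) (M2 := M2)
  Sf Sg fd gd H.
rewrite [A ++ [::]]cats0.
apply; [| |exact: p1|exact: ok1|exact: p2|exact: ok2|exact: ED].
- move=> m1 m2 [q1 k1 q2 k2 E].
  have Ep := congr1 (@dpos X) E; rewrite !dpos_dframe // in Ep.
  have [hf <-] := common_center Sf fd q1 k1.
  have [hg <-] := common_center Sg gd q2 k2.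
  by rewrite -Ep in hg *; apply: GS; apply: Comp_inter.
move=> nc sf sg x.
have hn m : ~~ ((m \in posP lt [::] f b) && (m \in posP lt a g [::])).
  apply/negP => /andP[].
  move=> /(posP_cpos _ _ _ (lpos_bounds Sf)) [m1 [q1 h1 E1]].
  move=> /(posP_cpos _ _ _ (lpos_bounds Sg)) [m2 [q2 h2 E2]].
  apply: nc; exists m1, m2; split=> //.
  apply: diword_inj; first by rewrite !dword_dframe.
  by rewrite !dpos_dframe // -Ef1 -Ef2 -Eg1 -Eg2 -E1 -E2.
have okf m : center_ok m f by right.
have okg m : center_ok m g by right.
split; apply: GS.
  have := Comp_inter_left x Sf Sg Ew' lt_fg' hn sf sg.
  by rewrite (nsdE (m := InL 1) Sf fd) // (nsdE (m := InL 1) Sg gd).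
have := Comp_inter_right x Sf Sg Ew' lt_fg' hn sf sg; cbv zeta.
rewrite (nsdE (m := InR (size b).+1) Sf fd) //; last first.
- by rewrite !size_cat Ef1 /=; lia.
- by rewrite /= size_cat addn1 leqnn.
rewrite (nsdE (m := InR 1) Sg gd) //.
by rewrite Ew' Eg1 !size_cat /=; lia.
Qed.

(** By symmetry the first occurrence starts no later than the second. Comparing where the first ends
    with where the second starts and ends selects one of the three preceding difference lemmas. *)
Lemma normal_difference D g1 g2 : normal D g1 -> normal D g2 ->
  nspan (fun e => dlt lt e D) (g1 - g2).
Proof.
suff main a1 b1 m1 s1 d1 a2 b2 m2 s2 d2 : (size a1 <= size a2)%N ->
    S s1 -> placeable a1 b1 m1 -> center_ok m1 s1 -> lead lt s1 = Some d1 ->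
    S s2 -> placeable a2 b2 m2 -> center_ok m2 s2 -> lead lt s2 = Some d2 ->
    dframe a1 b1 m1 d1 = dframe a2 b2 m2 d2 ->
    nspan (fun e => dlt lt e (dframe a1 b1 m1 d1))
      (frame a1 b1 m1 s1 - frame a2 b2 m2 s2).
  case=> a1 b1 m1 s1 d1 Ss1 p1 ok1 sd1 n2.
  (* The index is generalized so that the second normal S-diword can be destructed too. *)
  set D1 := dframe a1 b1 m1 d1 in n2 *.
  have E : dframe a1 b1 m1 d1 = D1 by [].
  clearbody D1; case: n2 E => a2 b2 m2 s2 d2 Ss2 p2 ok2 sd2 E.
  have [le|/ltnW le] := leqP (size a1) (size a2).
    rewrite -E.
    exact: (main _ _ _ _ _ _ _ _ _ _ le Ss1 p1 ok1 sd1 Ss2 p2 ok2 sd2 E).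
  rewrite -[_ - _]opprB -scaleN1r; apply: lspanZ.
  exact: (main _ _ _ _ _ _ _ _ _ _ le Ss2 p2 ok2 sd2 Ss1 p1 ok1 sd1 (esym E)).
move=> le Ss1 p1 ok1 sd1 Ss2 p2 ok2 sd2 ED.
have Epos := congr1 (@dpos X) ED; rewrite !dpos_dframe // in Epos.
have := congr1 (@dword X) ED; rewrite !dword_dframe //.
case/cat_eq_split=> // a Ea E1; subst a2.
have [le1|lt1] := leqP (size (dword d1)) (size a).
  have [c Ec Eb1] := cat_eq_split E1 le1; subst a b1.
  by apply: disjoint_difference.
have [le2|lt2] := leqP (size (a ++ dword d2)) (size (dword d1)).
  have [|b Eb Eb2] := @cat_eq_split _ (a ++ dword d2) (dword d1) b2 b1 _ le2.
    by rewrite -catA.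
  subst b2; apply: (inclusion_difference _ _ _ _ _ p1 ok1 p2 ok2 ED) => //.
  by rewrite Eb -catA.
(* This also covers empty [a], where the first word is a proper prefix of the second: compositions
   of intersection allow it. *)
have [|b Eb Eb1] :=
    @cat_eq_split _ (dword d1) (a ++ dword d2) b1 b2 _ (ltnW lt2).
  by rewrite -catA.
subst b1; apply: (intersection_difference _ _ _ _ _ _ p1 ok1 p2 ok2 ED) => //.
by rewrite -Eb size_cat ltn_add2r.
Qed.

(** * Leading diwords of combinations of normal S-diwords *)

Lemma nspan_suppb Q f : (forall d e, dle lt d e -> Q e -> Q d) ->
  nspan Q f -> suppb Q f.
Proof.
move=> Qle; elim=> [|c g f' [d Qd nd] _ IH]; first exact: suppb0.
apply: suppb_lin IH => e ge; apply: Qle Qd.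
by have [/(leadP lt_mo)[_ /(_ e ge)]] := normal_lead nd.
Qed.

Lemma nspan_dltP D f : nspan (fun e => dlt lt e D) f ->
  f = 0 \/ exists2 e, dlt lt e D & nspan (fun d => dle lt d e) f.
Proof.
elim=> [|c g f' [d dD nd] hf' IH]; first by left.
right; case: IH => [->|[e eD he]].
  exists d => //; rewrite addr0; apply: lspanZ.
  by apply: normal_nspan nd; apply: dle_refl.
have [de|/dltW ed] := dle_total lt_mo d e.
  by exists e => //; apply: lspan_cons he; exists d.
exists d => //; apply: lspan_cons; first by exists d => //; apply: dle_refl.
by apply: nspan_mono he => i ie; apply: dle_trans ed.
Qed.

(** By [normal_difference], generators that share the index [D] are merged into one, with added
    coefficients, modulo lower terms. *)
Lemma nspan_dle_split D f : nspan (fun e => dle lt e D) f ->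
  nspan (fun e => dlt lt e D) f \/
  exists g (c : k), normal D g /\ nspan (fun e => dlt lt e D) (f - c *: g).
Proof.
elim=> [|c g f' [d + nd] _ IH]; first by left; apply: lspan0.
case/predU1P=> [Ed|dD].
  right; rewrite Ed in nd; case: IH => [hf'|[g0 [c0 [n0 hf']]]].
    by exists g, c; rewrite addrC addKr.
  exists g0, (c + c0); split; first exact: n0.
  rewrite scaler_swap; apply: lspanD hf'.
  exact: lspanZ (normal_difference nd n0).
case: IH => [hf'|[g0 [c0 [n0 hf']]]].
  by left; apply: lspan_cons hf'; exists d.
right; exists g0, c0; split; first exact: n0.
rewrite -addrA.
by apply: lspan_cons hf'; exists d.
Qed.

(** Once the generators of index [D] are merged into [c *: g], either [c = 0] and the bound drops,
    or the coefficient at [D] is [c] and nothing cancels it. *)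
Lemma nspan_lead D f : nspan (fun e => dle lt e D) f -> f != 0 ->
  exists d g, normal d g /\ lead lt f = Some d.
Proof.
elim/(well_founded_ind (dlt_wf lt_mo)): D f => D IH f.
have low f' : nspan (fun e => dlt lt e D) f' -> f' != 0 ->
    exists d g, normal d g /\ lead lt f' = Some d.
  move=> /nspan_dltP[->|[e eD he]]; first by rewrite eqxx.
  exact: IH eD _ he.
case/nspan_dle_split=> [/low//|[g [c [ng]]]].
have [->|c0] := eqVneq c 0; first by rewrite scale0r subr0; apply: low.
move=> hr _; exists D, g; split=> //.
have [/(leadP lt_mo)[_ hg] gD] := normal_lead ng.
have {}hr : suppb (fun e => dlt lt e D) (f - c *: g).
  by apply: nspan_suppb hr => d e; apply: dle_dlt_trans.
rewrite -[f](subrK (c *: g)) addrC; apply/leadP => //; split.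
  rewrite dcoefD dcoefZ gD mulr1; set r := dcoef _ _.
  suff -> : r = 0 by rewrite addr0.
  by apply/eqP; apply: contraFT (dlt_irr lt_mo D) => /hr.
by apply: suppb_lin => //; apply: suppb_mono hr => e; apply: dltW.
Qed.

Lemma linear_closed (F : Di k X -> Di k X) (I : Di k X -> Prop) :
  linear F -> I 0 -> (forall (c : k) f g, I f -> I g -> I (c *: f + g)) ->
  (forall d, I (F (diU d))) -> forall g, I (F g).
Proof.
move=> lF I0 IL IU; apply: (@Di_ind k X) => [|c d f IH].
  by have := linB lF 0 0; rewrite !subrr => ->.
by rewrite lF; apply: IL.
Qed.

(** The span of the normal S-diwords is an ideal containing [S], to which the definition of [Id] is
    applied. By linearity, products need only be checked against diwords, where they are frames. *)
Lemma Id_nspan f : Id S f -> nspan (fun=> True) f.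
Proof.
apply; last first.
  move=> s Ss; have [d sd _] := dmonicP lt_mo (S_monic Ss).
  rewrite -[s]frame_nil.
  apply: (normal_nspan (d := dframe [::] [::] InM d)) => //.
  by apply: Normal => //; left.
pose I := nspan (fun=> True).
have IF A B M g : placeable A B M -> I g -> I (frame A B M g).
  move=> pM; apply: lspan_linear => h [d _ /(frame_normal pM)].
  by apply: nspan_mono.
have I0 : I 0 by apply: lspan0.
have IL (c : k) g h : I g -> I h -> I (c *: g + h).
  by move=> Ig; apply: lspanD; apply: lspanZ.
split=> // {}f g If; have db := @diword_bounds X.
split.
- apply: (linear_closed (vdash_linr f)) => // d.
  rewrite -diw_diword (vdash_diw_frame _ (db d)).
  by apply: (IF _ _ _ _ _ If); rewrite /= ?db.
- apply: (linear_closed (dashv_linr f)) => // d.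
  rewrite -diw_diword (dashv_diw_frame _ (db d)).
  by apply: (IF _ _ _ _ _ If); rewrite /= ?db.
- apply: (linear_closed (vdash_linl f)) => // d.
  rewrite -diw_diword (diw_vdash_frame _ (db d)).
  by apply: (IF _ _ _ _ _ If); rewrite /= ?db.
apply: (linear_closed (dashv_linl f)) => // d.
rewrite -diw_diword (diw_dashv_frame _ (db d)).
by apply: (IF _ _ _ _ _ If); rewrite /= ?db.
Qed.

Lemma GS_lead f : Id S f -> f != 0 ->
  exists2 h, normal_diwords lt S h & lead lt f = lead lt h.
Proof.
(* The finitely many generators of a combination have a largest index, which bounds the induction in
   [nspan_lead]. *)
move=> /Id_nspan hf f0; have [D hD] : exists D, nspan (fun e => dle lt e D) f.
  elim: hf f0 => [|c g f' [d _ nd] _ IH _]; first by rewrite eqxx.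
  have hg : nspan (fun e => dle lt e d) g.
    by apply: normal_nspan nd; apply: dle_refl.
  have [->|/IH[D hD]] := eqVneq f' 0.
    by exists d; rewrite addr0; apply: lspanZ.
  have [dD|/dltW Dd] := dle_total lt_mo d D.
    exists D; apply: lspanD hD; apply: lspanZ.
    by apply: nspan_mono hg => e ed; apply: dle_trans dD.
  exists d; apply: lspanD; first exact: lspanZ.
  by apply: nspan_mono hD => e ed; apply: dle_trans Dd.
have [d [g [ng ->]]] := nspan_lead hD f0.
by exists g; [apply/normal_diwordsP; exists d|have [-> _] := normal_lead ng].
Qed.

End Normal.

Theorem theorem3p18 (k : fieldType) (disp : Order.disp_t) (X : orderType disp)
    (X_wf : well_founded (fun x y : X => (x < y)%O))
    (S : set (Di k X)) (lt : rel (seq X)) (lt_mo : monomial_order lt)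
    (S_monic : forall s, S s -> dmonic lt s) :
  (GS_basis lt S <->
     (forall f : Di k X, Id S f -> f != 0 ->
        exists2 h, normal_diwords lt S h & lead lt f = lead lt h)) /\
  ((forall f : Di k X, Id S f -> f != 0 ->
      exists2 h, normal_diwords lt S h & lead lt f = lead lt h) <->
   Irr_basis lt S).
Proof.
split; split.
- move=> GS f; exact: (GS_lead lt_mo S_monic GS).
- exact: (lead_closed_GS lt_mo S_monic).
- exact: (lead_closed_basis lt_mo S_monic).
exact: (basis_lead_closed lt_mo).
Qed.
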